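(* Let $G$ be a graph of order $n$ and let $k$ be a positive integer. Suppose that $\sigma_{k+1}(G)\geq n$ and that every nonempty independent set $I$ of $G$ satisfies $|I|\leq \delta_G(I)-1$. If there is a cut set $S\subseteq V(G)$ of $G$ with $\omega(G-S)\geq |S|+k-1$, then $G$ has a 2-factor with at most $k$ cycles.
   Context: All graphs are simple, finite and undirected. The order of $G$ is its number of vertices. $d_G(v)$ denotes the degree of a vertex $v$ in $G$, and $\alpha(G)$ the independence number. For a nonempty independent set $I$ of $G$, $\delta_G(I):=\min\{d_G(v)\mid v\in I\}$. For a positive integer $m$, $\sigma_m(G):=\min\{\sum_{v\in I}d_G(v)\mid I \text{ is an independent set of } G \text{ with } |I|=m\}$ if $\alpha(G)\geq m$, and $\sigma_m(G):=\infty$ otherwise. A cut set of $G$ is a set $S\subseteq V(G)$ such that $G-S$ is disconnected, and $\omega(G-S)$ denotes the number of connected components of $G-S$. A 2-factor of a graph is a spanning 2-regular subgraph; its cycles are its connected components. *)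

(* Defs.v *)
From mathcomp Require Import all_boot.

Set Implicit Arguments.
Unset Strict Implicit.
Unset Printing Implicit Defensive.

(* MathComp; a simple graph is a symmetric irreflexive relation [e] on a finite
   type [T] of vertices. *)
Section Graph.

Variables (T : finType) (e : rel T).
Implicit Types (I S : {set T}) (v : T).

Definition degree v : nat := #|[set u | e v u]|.

Definition independent I : bool := [forall u in I, forall v in I, ~~ e u v].

Definition alpha : nat := \max_(I : {set T} | independent I) #|I|.

(* Every degree is at most [#|T|], so the starting value of the iterated
   minimum is harmless as soon as [I] is nonempty. *)
Definition min_degree I : nat := \big[minn/#|T|]_(v in I) degree v.

(* [None] stands for infinity.  The starting value of the iterated minimum
   bounds every degree sum it ranges over. *)
Definition sigma (m : nat) : option nat :=
  if m <= alpha then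
    Some (\big[minn/(\sum_v degree v)]_(I : {set T} |
            independent I && (#|I| == m)) \sum_(v in I) degree v)
  else None.

(* The edges of G - S; its vertex set is [~: S]. *)
Definition del S : rel T := [rel u v | [&& u \notin S, v \notin S & e u v]].

Definition omega S : nat := n_comp (del S) (~: S).

Definition cut_set S : Prop :=
  exists u v, [/\ u \notin S, v \notin S & ~~ connect (del S) u v].

End Graph.

(* [F] is the adjacency relation of a spanning subgraph of [e]. *)
Definition two_factor (T : finType) (e F : rel T) : Prop :=
  [/\ symmetric F, subrel F e & forall v, degree F v = 2].

(* The number of cycles of a 2-factor is its number of components. *)
Definition num_cycles (T : finType) (F : rel T) : nat := n_comp F T.

Definition leq_inf (n : nat) (s : option nat) : bool :=
  if s is Some k then n <= k else true.

(* Main.v *)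
Require Import Defs.
From mathcomp Require Import all_boot.
From mathcomp Require Import zify.

Set Implicit Arguments.
Unset Strict Implicit.
Unset Printing Implicit Defensive.

(** Let [S] be the cut set, [s] its size and [m] the number of components of
    [G - S].  One vertex from each component makes an independent set, so every
    vertex outside [S] has degree at least [m + 1]; it has fewer than [|C| + s]
    neighbours, [C] being its component, so all components have at least
    [m + 2 - s] vertices.  Hence [k + 1] independent vertices spread over the
    components, whose degrees add up to at least [n = s + \sum |C|], can miss
    very few of the neighbours that their components and [S] offer
    ([parts_degree_sum]).  Three cases follow.

    If [m > k], then [m = s + k - 1], and so few adjacencies are missing that at
    least [s] components are complete and completely joined to [S].  One cycle
    runs alternately through the vertices of [S] and [s] of these components
    ([weave_cover]); each of the other [k - 1] components satisfies Ore's degree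
    condition, so it is Hamiltonian ([cover_many_parts]).

    If [m = k], then [s <= 1].  When [s = 0], every component satisfies Ore's
    condition.  When [S] is a single vertex [x], all components but one satisfy
    it, and [x] has two neighbours in the remaining one, [C]; the closure
    argument behind Ore's theorem then gives a Hamiltonian cycle of [C + x]
    ([cover_one_cut]).

    If [m < k], then [S] is empty and [m = k - 1].  All components but one
    satisfy Ore's condition, so it is enough to cover the exceptional one, [A],
    by at most two cycles.  Should [A] have a cut vertex or be disconnected,
    then removing that vertex (or none) splits the graph into [k] pieces with no
    edges between them, and the second case applies.  Otherwise [A] is
    2-connected, any three independent vertices of [A] have degree sum above
    [|A|], and an independent set of [A] containing [v] has at most
    [degree v - 2] elements.  Take a longest cycle [c] of [A] and a component [K]
    of [A - c].  Chord counting around [c] turns the degree-sum bound into an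
    equality ([outside_component]): [K] is complete, all its vertices have the
    same neighbours on [c], and each further vertex outside [c] is adjacent to
    exactly one of the successors of any two of these neighbours.  The last
    property leaves no room for a second component of [A - c], so [c] and a
    Hamiltonian cycle of [K] cover [A] ([two_cycles]).

    To allow that reduction, the first two cases are stated for arbitrary
    separations [lab : T -> I] of the complement of [S]. *)

(** * Covers by disjoint cycles *)

(** Linear arithmetic in which cardinals, degrees and counts are opaque numbers;
    comparing them up to conversion would be costly. *)
Ltac nat_lia := intros;
  repeat match goal with
    | H : is_true (leq _ _) |- _ => revert H
    | H : @eq nat _ _ |- _ => revert H
    end;
  repeat match goal with
    | |- context [@card ?T ?A] =>
        let n := fresh "n" in generalize (@card T A); intro n
    | |- context [@degree ?T ?e ?v] =>
        let n := fresh "n" in generalize (@degree T e v); intro n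
    | |- context [@count ?T ?P ?s] =>
        let n := fresh "n" in generalize (@count T P s); intro n
    end;
  clear; lia.

Section CycleCovers.

Variables (T : finType) (e : rel T).
Hypotheses (e_sym : symmetric e) (e_irr : irreflexive e).

(** Lists of cycles, rather than edge relations, so that covers of disjoint sets
    are simply concatenated. *)
Definition cycle_cover (A : {set T}) (k : nat) : Prop :=
  exists Ls : seq (seq T),
    [/\ size Ls <= k, all (fun L => cycle e L && (2 < size L)) Ls,
        uniq (flatten Ls) & flatten Ls =i A].

Lemma cycle_cover0 : cycle_cover set0 0.
Proof. by exists [::]; split=> // v; rewrite inE. Qed.

Lemma cycle_cover1 (A : {set T}) L :
  cycle e L -> 2 < size L -> uniq L -> L =i A -> cycle_cover A 1.
Proof.
move=> cL sL uL LA; exists [:: L]; rewrite /= cats0 cL sL uL; split=> //.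
Qed.

Lemma cycle_cover_le (A : {set T}) k k' :
  k <= k' -> cycle_cover A k -> cycle_cover A k'.
Proof.
by move=> kk' [Ls [sz cyc un mem]]; exists Ls; split=> //; apply: leq_trans kk'.
Qed.

Lemma cycle_coverU (A B : {set T}) k l : [disjoint A & B] ->
  cycle_cover A k -> cycle_cover B l -> cycle_cover (A :|: B) (k + l).
Proof.
move=> dAB [Ls [szA cycA unA memA]] [Ms [szB cycB unB memB]].
exists (Ls ++ Ms); rewrite size_cat leq_add // all_cat cycA cycB flatten_cat.
split=> //; last by move=> v; rewrite mem_cat memA memB inE.
rewrite cat_uniq unA unB andbT /=; apply/hasPn => v.
rewrite memB /= memA => vB; apply/negP => vA.
by move/disjointFr: dAB => /(_ _ vA); rewrite vB.
Qed.

Lemma cycle_cover_bigcup (I : finType) (J : {set I}) (C : I -> {set T}) :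
    (forall i, i \in J -> cycle_cover (C i) 1) ->
    (forall i j, i \in J -> j \in J -> i != j -> [disjoint C i & C j]) ->
  cycle_cover (\bigcup_(i in J) C i) #|J|.
Proof.
have [n] := ubnP #|J|; elim: n J => // n IH J Jn cov dis.
have [-> | [i iJ]] := set_0Vmem J.
  by rewrite big_set0 cards0; apply: cycle_cover0.
rewrite (big_setD1 i iJ) (cardsD1 i J) iJ /=.
apply: cycle_coverU (cov i iJ) _.
  apply/bigcup_disjointP => j /setD1P[ji jJ]; apply: dis => //.
  by rewrite eq_sym.
apply: IH => [|j /setD1P[_] /cov //|j l /setD1P[_ jJ] /setD1P[_ lJ]].
  by move: Jn; rewrite (cardsD1 i J) iJ.
exact: dis.
Qed.

(** If both were [w], then the vertex after [w] would be [v] itself, closing a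
    cycle of length 2. *)
Lemma next_neq_prev (L : seq T) v :
  uniq L -> 2 < size L -> v \in L -> next L v != prev L v.
Proof.
move=> uL sL vL; have [i s defs] := rot_to vL.
have us : uniq (v :: s) by rewrite -defs rot_uniq.
have ss : 1 < size s by rewrite -(size_rot i) defs in sL.
case: s us ss defs => [|w [|z s]] //= /and3P[]; rewrite !inE.
case/norP=> vw /norP[vz _] _ _ _ defs.
have nv : next L v = w by rewrite -(next_rot i uL) defs /= eqxx.
have nw : next L w = z.
  by rewrite -(next_rot i uL) defs /= eqxx eq_sym (negPf vw).
rewrite nv; apply/eqP => wp.
by move: (next_prev uL v); rewrite -wp nw => zv; rewrite zv eqxx in vz.
Qed.

Lemma flatten_uniq_mem (Ls : seq (seq T)) L M v :
  uniq (flatten Ls) -> L \in Ls -> M \in Ls -> v \in L -> v \in M -> L = M.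
Proof.
elim: Ls => //= N Ls IH; rewrite cat_uniq => /and3P[_ /hasPn dis un].
have out K : K \in Ls -> v \in K -> v \in N -> False.
  move=> KL vK vN; have vf : v \in flatten Ls by apply/flattenP; exists K.
  by have := dis v vf; rewrite /= vN.
rewrite !inE => /predU1P[->|LL] /predU1P[->|ML] // vL vM.
- by case: (out M).
- by case: (out L).
exact: IH.
Qed.

(** A vertex is joined to its successor and its predecessor on the cycle that
    contains it; these differ since the cycle has length at least 3.  Each
    component contains the first vertex of some listed cycle. *)
Lemma cycle_cover_two_factor k :
  cycle_cover setT k -> exists2 F : rel T, two_factor e F & num_cycles F <= k.
Proof.
case=> Ls [szLs /allP cyc un mem].
pose F : rel T := fun u v =>
  has (fun L => (u \in L) && ((v == next L u) || (v == prev L u))) Ls.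
have uniqL L : L \in Ls -> uniq L.
  move=> LL; elim: (Ls) un LL {cyc mem szLs F} => //= M Ms IH.
  rewrite cat_uniq inE => /and3P[uM _ uMs] /predU1P[->|] //; exact: IH.
have coverL v : exists2 L, L \in Ls & v \in L.
  by apply/flattenP; rewrite mem inE.
have F_sym : symmetric F.
  suff sub u v : F u v -> F v u by move=> u v; apply/idP/idP; apply: sub.
  case/hasP=> L LL /andP[uL /orP[]/eqP->]; apply/hasP; exists L => //.
    by rewrite mem_next uL prev_next ?eqxx ?orbT ?uniqL.
  by rewrite mem_prev uL next_prev ?eqxx ?uniqL.
exists F.
  split=> // [u v|v].
    case/hasP=> L LL /andP[uL]; have /andP[cL _] := cyc _ LL.
    case/orP=> /eqP->; first exact: next_cycle cL uL.
    by rewrite e_sym; apply: prev_cycle cL uL.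
  have [L LL vL] := coverL v; have /andP[cL sL] := cyc _ LL.
  have -> : 2 = #|[set next L v; prev L v]|.
    by rewrite cards2 next_neq_prev // uniqL.
  apply: eq_card => u; rewrite !inE; apply/hasP/idP=> [[M MM /andP[vM]]|uNP].
    by rewrite (flatten_uniq_mem un LL MM vL vM).
  by exists L; rewrite ?vL.
have F_csym : connect_sym F by apply: connect_sym_sym || exact: sym_connect_sym.
have cycF L : L \in Ls -> cycle F L.
  move=> LL; apply: cycle_from_next (uniqL _ LL) _ => x xL.
  by apply/hasP; exists L; rewrite // xL eqxx.
rewrite /num_cycles; apply: leq_trans szLs.
case: Ls cyc un mem F uniqL coverL F_sym F_csym cycF => [|L0 Ls] cyc un mem F.
  move=> _ cov _ _ _; rewrite [n_comp_mem _ _]eq_card0 // => v.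
  by have [] := cov v.
move=> uniqL coverL F_sym F_csym cycF.
have [x0 _] : exists x0, x0 \in L0.
  by have /andP[_] := cyc _ (mem_head _ _); case: (L0) => // x s; exists x;
     rewrite mem_head.
have -> : size (L0 :: Ls) = size [seq root F (head x0 L) | L <- L0 :: Ls].
  by rewrite size_map.
apply: leq_trans (card_size _); apply: subset_leq_card; apply/subsetP => r.
case/andP=> /eqP rr _; have [L LL rL] := coverL r.
apply/mapP; exists L => //; rewrite -{1}rr; apply/(rootP F_csym).
by apply: (connect_cycle (cycF _ LL)) => //; case: (L) rL => //= x s;
   rewrite mem_head.
Qed.

Let nonedges x s := count negb (pairmap e x s).

Let nonedges_cat x s t : nonedges x (s ++ t) = nonedges x s + nonedges (last x s) t.
Proof. by rewrite /nonedges pairmap_cat count_cat. Qed.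

Let nonedges_cons x y s : nonedges x (y :: s) = ~~ e x y + nonedges y s.
Proof. by []. Qed.

Let nonedges_rcons x s y : nonedges x (rcons s y) = nonedges x s + ~~ e (last x s) y.
Proof. by rewrite -cats1 nonedges_cat /nonedges /= addn0. Qed.

Let nonedges_rev x s : nonedges (last x s) (rev (belast x s)) = nonedges x s.
Proof.
elim: s x => [|y s IH] x //=; rewrite rev_cons nonedges_rcons IH.
suff -> : last (last y s) (rev (belast y s)) = y.
  by rewrite /nonedges /= addnC e_sym.
by case: s {IH} => //= z s; rewrite rev_cons last_rcons.
Qed.

Let nonedges_path x s : (nonedges x s == 0) = path e x s.
Proof.
elim: s x => [|y s IH] x //=; rewrite -IH /nonedges /= addn_eq0 eqb0 negbK.
by [].
Qed.

(** Both counts run over the [size s] consecutive pairs of [z :: s], the second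
    entry being tested by [X] and the first one by [Y]; so some pair passes both
    tests. *)
Lemma crossing (X Y : pred T) z s : size s < count X s + count Y (belast z s) ->
  exists t w r, [/\ s = t ++ w :: r, Y (last z t) & X w].
Proof.
elim: s z => [|w s IH] z //= sz.
have [/andP[Yz Xw] | nXY] := boolP (Y z && X w).
  by exists [::], w, s.
have /IH[t [w' [r [-> Yt Xw]]]] : size s < count X s + count Y (belast w s).
  by move: nXY sz; case: (Y z); case: (X w) => //= _; lia.
by exists (w :: t), w', r.
Qed.

(** The Bondy-Chvatal closure argument.  When the closing pair [(v, y)] of the
    arrangement [y ... z w ... v] is not an edge, the degree condition yields
    consecutive [z], [w] with [v ~ z] and [y ~ w].  Reversing the segment from [w]
    to [v] replaces the pairs [(v, y)] and [(z, w)] by two edges of [e], so the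
    number of non-edges drops, and the arrangement is still a cycle of [e']. *)
Lemma ore_closure (e' : rel T) L : symmetric e' -> subrel e e' ->
    cycle e' L -> uniq L ->
    {in L &, forall u v, e' u v -> ~~ e u v ->
       size L <= count (e u) L + count (e v) L} ->
  exists2 M, perm_eq M L & cycle e M.
Proof.
move=> e'_sym ee'.
case: L => [|x s]; first by exists [::].
have [n] := ubnP (nonedges x (rcons s x)); elim: n x s => // n IH x s bn cL uL ore.
have [b0 | b_gt0] := posnP (nonedges x (rcons s x)).
  by exists (x :: s) => //=; rewrite -nonedges_path b0.
have [y [t [pyt cyt byt nbad]]] : exists y t, [/\ perm_eq (y :: t) (x :: s),
    cycle e' (y :: t), nonedges y (rcons t y) = nonedges x (rcons s x)
    & ~~ e (last y t) y].
  (* Rotate so that a missing edge becomes the closing pair. *)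
  have [t [w [r [defs ntw]]]] : exists t w r,
      rcons s x = t ++ w :: r /\ ~~ e (last x t) w.
    move: b_gt0; rewrite lt0n nonedges_path.
    move: (rcons s x) => q; elim: q (x) => //= y t IHt z.
    rewrite negb_and; have [ezy /=|nzy _] := boolP (e z y); last first.
      by exists [::], y, t.
    by case/IHt=> t1 [w [r [-> nb]]]; exists (y :: t1), w, r.
  case: (lastP r) defs => [|r' x'] defs.
    have [def_s def_x] : (s, x) = (t, w) by apply: rcons_inj; rewrite defs cats1.
    by rewrite -def_s -def_x in ntw; exists x, s.
  move: defs; rewrite -rcons_cons -rcons_cat => /rcons_inj[def_s _].
  exists w, (r' ++ x :: t); split.
  - by rewrite def_s -!cat_cons perm_catC.
  - by move: cL; rewrite def_s -!cat_cons cycle_catC.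
  - rewrite def_s !rcons_cat !rcons_cons !nonedges_cat.
    by rewrite !nonedges_cons !nonedges_rcons; lia.
  by rewrite last_cat.
set v := last y t in nbad.
have mem_yt z : (z \in y :: t) = (z \in x :: s) by apply: perm_mem.
have vL : v \in x :: s by rewrite -mem_yt mem_last.
have yL : y \in x :: s by rewrite -mem_yt mem_head.
have e'vy : e' v y by move: cyt; rewrite /= rcons_path => /andP[].
have := ore _ _ vL yL e'vy nbad; rewrite -!(permP pyt) -(perm_size pyt).
rewrite {2}lastI -cats1 count_cat /= -/v !e_irr !addn0 add0n addnC.
move=> gt_t; have [t1 [w [r [def_t ev ew]]]] := crossing gt_t.
have e'w := ee' _ _ ew; have e'v := ee' _ _ ev.
have last_r : last w r = v by rewrite /v def_t last_cat.
have rev_r : rev (w :: r) = v :: rev (belast w r).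
  by rewrite lastI rev_rcons last_r.
have perm_new : perm_eq (y :: t1 ++ rev (w :: r)) (x :: s).
  apply: perm_trans pyt; rewrite def_t perm_cons perm_cat2l.
  by rewrite perm_rev.
have last_new : last y (t1 ++ rev (w :: r)) = w.
  by rewrite last_cat rev_cons last_rcons.
have [M pM cM] : exists2 M, perm_eq M (y :: t1 ++ rev (w :: r)) & cycle e M.
  apply: IH.
  - rewrite -ltnS; apply: leq_trans bn; rewrite -byt !nonedges_rcons last_new.
    rewrite -/v nbad def_t rev_r !nonedges_cat !nonedges_cons -last_r nonedges_rev.
    rewrite last_r e_sym ev [e w y]e_sym ew.
    move: (nonedges y t1) (nonedges w r) (e (last y t1) w) => a b d.
    by clear; case: d; lia.
  - rewrite /= rcons_path last_new [e' w y]e'_sym e'w andbT.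
    move: cyt; rewrite /= rcons_path def_t cat_path => /andP[/and3P[pt1 _ pr] _].
    rewrite rev_r cat_path pt1 /= [e' _ v]e'_sym e'v /=.
    by rewrite -last_r rev_path; apply: sub_path pr => a b; rewrite e'_sym.
  - by rewrite (perm_uniq perm_new).
  move=> a b; rewrite !(perm_mem perm_new) => aL bL.
  by rewrite !(permP perm_new) (perm_size perm_new); apply: ore.
by exists M => //; apply: perm_trans perm_new.
Qed.

End CycleCovers.

(** * Chords of a longest cycle *)

Section LongestCycle.

Variables (T : finType) (e : rel T) (A : {set T}).
Hypotheses (e_sym : symmetric e) (e_irr : irreflexive e).

Definition longest_cycle (c : seq T) : Prop :=
  [/\ cycle e c, uniq c, {subset c <= A} &
      forall L, uniq L -> cycle e L -> {subset L <= A} -> size L <= size c].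

Definition avoids (c q : seq T) : Prop :=
  [/\ uniq q, {subset q <= A} & ~~ has (mem c) q].

Lemma longest_cycle_rot i c : longest_cycle c -> longest_cycle (rot i c).
Proof.
case=> cc uc sc mc; split; rewrite ?rot_cycle ?rot_uniq ?size_rot //.
by move=> v; rewrite mem_rot => /sc.
Qed.

Lemma avoids_rot i c q : avoids c q -> avoids (rot i c) q.
Proof.
case=> uq sq nq; split=> //; rewrite (eq_has (a2 := mem c)) // => v.
by rewrite /= mem_rot.
Qed.

(** A cycle [L] built from [c] by giving up [junk] and taking in [q] is no longer
    than [c]. *)
Lemma longest_exchange c q L junk : longest_cycle c -> avoids c q ->
  perm_eq (junk ++ L) (c ++ q) -> cycle e L -> size q <= size junk.
Proof.
move=> [cc uc sc mc] [uq sq nq] pL cL.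
have : uniq (junk ++ L) by rewrite (perm_uniq pL) cat_uniq uc nq.
rewrite cat_uniq => /and3P[_ _ uL].
have sL : {subset L <= A}.
  move=> v vL; have : v \in junk ++ L by rewrite mem_cat vL orbT.
  by rewrite (perm_mem pL) mem_cat => /orP[/sc|/sq].
have := perm_size pL; rewrite !size_cat => sz.
by rewrite -(leq_add2l (size c)) -sz addnC leq_add2r mc.
Qed.

(** Traversing [q] backwards from [b] to [z] is, by symmetry, the same as
    traversing it forwards from [z] to [b]. *)
Lemma path_rev_cat b q z s :
  path e b (rev q ++ z :: s) = path e z (rcons q b) && path e z s.
Proof.
rewrite -cat_rcons -rev_cons cat_path.
have -> : z :: q = belast z (rcons q b) by rewrite belast_rcons.
rewrite -{1}[b](last_rcons z q) rev_path (eq_path (e' := e)) //.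
congr (_ && _); rewrite belast_rcons rev_cons last_rcons //.
Qed.

Lemma cycle_two x t1 y t2 : cycle e ((x :: t1) ++ (y :: t2)) ->
  [/\ path e x t1, e (last x t1) y, path e y t2 & e (last y t2) x].
Proof.
by rewrite /= rcons_cat rcons_cons cat_path /= rcons_path => /and4P.
Qed.

Lemma longest_no_insertion x t q : longest_cycle (x :: t) ->
  avoids (x :: t) q -> path e (last x t) (rcons q x) -> q = [::].
Proof.
move=> lc aq pq; apply: size0nil; apply/eqP; rewrite -leqn0.
apply: (longest_exchange (junk := [::]) lc aq (perm_refl _)).
have [cc _ _ _] := lc; rewrite /= rcons_cat cat_path pq andbT.
by move: cc; rewrite /= rcons_path => /andP[].
Qed.

(** The bound [n] on the number of inner vertices matters: a detour with two of
    them still lengthens the cycle when it makes it skip a vertex. *)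
Definition detour (c : seq T) (n : nat) (a b : T) : Prop :=
  exists q, [/\ avoids c q, path e a (rcons q b) & n <= size q].

Lemma detour_sym c n a b : detour c n a b -> detour c n b a.
Proof.
case=> q [[uq sq nq] pq sz]; exists (rev q); rewrite size_rev; split=> //.
  split; rewrite ?rev_uniq ?has_rev // => v.
  by rewrite mem_rev => /sq.
by rewrite -cats1 path_rev_cat pq.
Qed.

Lemma detour_rot i c n a b : detour c n a b -> detour (rot i c) n a b.
Proof. by case=> q [av pq sz]; exists q; split=> //; apply: avoids_rot. Qed.

(** Charge to each position [f] of [s] whether [Y] holds at [f], [U] at the entry
    before it and [X] at the entry after it.  If the three counts exceed
    [size s], then some position is charged twice. *)
Lemma count_three (X Y U : pred T) z s :
    size s < count X (behead s) + count Y s + count U (belast z s) ->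
    (exists l f r, [/\ s = l ++ f :: r, Y f & U (last z l)])
  \/ (exists l f d r, [/\ s = l ++ f :: d :: r, X d & U (last z l) || Y f]).
Proof.
elim: s z => [|f s IH] z //= sz.
have [/andP[Uz Yf] | nUY] := boolP (U z && Y f); first by left; exists [::], f, s.
have [/andP[Xd UY] | nX] := boolP (has X (take 1 s) && (U z || Y f)).
  case: s Xd {IH sz} => //= d s; rewrite take0 /= orbF => Xd.
  by right; exists [::], f, d, s.
have /IH : size s < count X (behead s) + count Y s + count U (belast f s).
  move: sz nX nUY; case: (s) => [|d r] /=; case: (U z) => //=;
    case: (Y f) => //=; rewrite ?take0 /= ?orbF ?andbT; try lia;
    by case: (X d) => //=; lia.
case=> [[l [g [r [-> Yg Ul]]]] | [l [g [d [r [-> Xd UY]]]]]]; [left|right].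
  by exists (f :: l), g, r.
by exists (f :: l), g, d, r.
Qed.

(** In this section the cycle [c] runs from [x] to [b], then from [y] to [a]: the
    vertices [x] and [y] are the successors of [a] and [b].  Each of the next
    four lemmas exhibits a cycle that is too long unless the configuration is
    absent. *)
Section Chords.

Variables (x y : T) (t1 t2 : seq T).
Let c := (x :: t1) ++ (y :: t2).
Let a := last y t2.
Let b := last x t1.
Hypothesis c_longest : longest_cycle c.

Let c_steps := cycle_two (let: And4 cc _ _ _ := c_longest in cc).

(** The cycle [x w y ... a q b ... x], whose last stretch is reversed. *)
Lemma longest_no_bypass w q : avoids c (w ++ q) ->
  path e x (rcons w y) -> path e a (rcons q b) -> w ++ q = [::].
Proof.
move=> av pw pq; apply: size0nil; apply/eqP; rewrite -leqn0.
have [p1 eby p2 eax] := c_steps.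
apply: (@longest_exchange c _ (x :: w ++ (y :: t2) ++ q ++ rev t1)
  [::] c_longest av).
  by apply/permP => f; rewrite /c /= ?count_cat /= ?count_cat ?count_rev /=; nat_lia.
move: pw pq; rewrite rcons_path => /andP[pw ewy].
rewrite rcons_path => /andP[pq eqb].
rewrite /= -cats1 -!catA cat_path pw /= ewy -catA cat_path p2 /= -/a.
rewrite -catA cat_path pq path_rev_cat rcons_path p1 /=.
by rewrite e_sym eqb.
Qed.

(** With [z = last x l], the vertex before [w]: the cycle
    [x ... z y ... a q b ... w], whose last stretch is reversed. *)
Lemma longest_no_crossing l w r q : t1 = l ++ w :: r -> avoids c q ->
  path e a (rcons q b) -> e y (last x l) -> e x w -> q = [::].
Proof.
move=> def_t1 av pq eyz exw; apply: size0nil; apply/eqP; rewrite -leqn0.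
have [p1 eby p2 eax] := c_steps.
apply: (@longest_exchange c _ ((x :: l) ++ (y :: t2) ++ q ++ rev (w :: r))
  [::] c_longest av).
  apply/permP => f; rewrite /c def_t1 /=.
  by do 4!rewrite ?count_cat ?count_rev /=; nat_lia.
move: pq; rewrite rcons_path => /andP[pq eqb].
move: p1 eqb; rewrite /b def_t1 cat_path last_cat /= => /and3P[pl _ pr] eqb.
rewrite /= -cats1 -!catA cat_path pl /= e_sym eyz -catA cat_path p2 /= -/a.
rewrite -catA cat_path pq rev_cons cat_rcons path_rev_cat rcons_path pr /=.
by rewrite e_sym eqb e_sym exw.
Qed.

(** With [g = last x l], the vertex before [f]: the cycle
    [x d ... b y ... a q g ... x], whose last stretch is reversed.  It leaves out
    [f], so a detour with two vertices makes it longer than [c]. *)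
Lemma longest_no_skip l f d r q : t1 = l ++ f :: d :: r -> avoids c q ->
  path e a (rcons q (last x l)) -> e x d -> size q <= 1.
Proof.
move=> def_t1 av pq exd.
have [p1 eby p2 eax] := c_steps.
apply: (@longest_exchange c _ (x :: (d :: r) ++ (y :: t2) ++ q ++ rev l)
  [:: f] c_longest av).
  apply/permP => g; rewrite /c def_t1 /=.
  by do 4!rewrite ?count_cat ?count_rev /=; nat_lia.
move: pq; rewrite rcons_path => /andP[pq eqb].
move: p1 eby; rewrite /b def_t1 cat_path last_cat /= => /and4P[pl _ _ pr] eby.
rewrite /= -cats1 -!catA exd cat_path pr /= eby -catA cat_path p2 /= -/a.
rewrite -catA cat_path pq path_rev_cat rcons_path pl /=.
by rewrite e_sym eqb.
Qed.

(** With [g = last x l], the vertex before [f]: the cycle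
    [y ... a x ... g q b ... f], whose last stretch is reversed. *)
Lemma longest_no_successor l f r q : t1 = l ++ f :: r -> avoids c q ->
  path e (last x l) (rcons q b) -> e y f -> q = [::].
Proof.
move=> def_t1 av pq eyf; apply: size0nil; apply/eqP; rewrite -leqn0.
have [p1 eby p2 eax] := c_steps.
apply: (@longest_exchange c _ (y :: t2 ++ (x :: l) ++ q ++ rev (f :: r))
  [::] c_longest av).
  apply/permP => g; rewrite /c def_t1 /=.
  by do 4!rewrite ?count_cat ?count_rev /=; nat_lia.
move: pq; rewrite rcons_path => /andP[pq eqb].
move: p1 eqb; rewrite /b def_t1 cat_path last_cat /= => /and3P[pl _ pr] eqb.
rewrite /= -cats1 -!catA cat_path p2 /= -/a eax -catA cat_path pl.
rewrite -catA cat_path pq rev_cons cat_rcons path_rev_cat rcons_path pr /=.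
by rewrite e_sym eqb e_sym eyf.
Qed.

(** Read along [x ... b], no position is charged twice in the sense of
    [count_three]: a vertex adjacent to [y] whose follower is adjacent to [x] is
    a crossing, a vertex adjacent to [y] just after a vertex of [U] is excluded by
    the detour to [b], and a vertex adjacent to [x] two steps after a vertex of
    [U] is excluded by the long detour from [a]. *)
Lemma chord_count_half (U : pred T) : detour c 1 a b ->
    (forall z, U z -> [/\ z != b, detour c 2 a z & detour c 1 z b]) ->
  count (e x) (x :: t1) + count (e y) (x :: t1) + count U (x :: t1)
    <= size (x :: t1).
Proof.
case=> q [av pq q_gt0] longU; rewrite leqNgt; apply/negP.
have no_cross l w r : t1 = l ++ w :: r -> e y (last x l) -> e x w -> False.
  move=> def_t1 eyz exw; move: q_gt0.
  by rewrite (longest_no_crossing def_t1 av pq eyz exw).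
have -> : count U (x :: t1) = count U (belast x t1).
  rewrite lastI -cats1 count_cat /= -/b; case: (boolP (U b)) => [/longU[]|_].
    by rewrite eqxx.
  by rewrite !addn0.
have [/andP[Yx Xf]|nYX] := boolP (e y x && has (e x) (take 1 t1)).
  case: t1 Xf no_cross => //= f r; rewrite take0 /= orbF => Xf.
  by move/(_ [::] f r erefl Yx Xf).
rewrite /= e_irr add0n => sz.
have /count_three : size t1 < count (e x) (behead t1) + count (e y) t1 +
    count U (belast x t1).
  move: sz nYX; case: (t1) => [|f r] /=; rewrite ?take0 /= ?orbF.
    by case: (e y x); lia.
  by case: (e y x); case: (e x f) => //=; lia.
case=> [[l [f [r [def_t1 Yf Ul]]]] | [l [f [d [r [def_t1 Xd /orP[Ul|Yf]]]]]]].
- have [_ _ [q' [av' pq' q'_gt0]]] := longU _ Ul.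
  by move: q'_gt0; rewrite (longest_no_successor def_t1 av' pq' Yf).
- have [_ [q' [av' pq' q'_gt1]] _] := longU _ Ul.
  by move: q'_gt1; rewrite ltnNge (longest_no_skip def_t1 av' pq' Xd).
apply: (no_cross (rcons l f) d r) => //; first by rewrite cat_rcons.
by rewrite last_rcons.
Qed.

End Chords.

(** The half count on [x ... b] and, with the roles of [x] and [y] exchanged, on
    [y ... a]. *)
Lemma chord_count x t1 y t2 (U : pred T) :
    let c := (x :: t1) ++ (y :: t2) in
    let a := last y t2 in let b := last x t1 in
    longest_cycle c -> detour c 1 a b ->
    (forall z, U z ->
       [/\ z != a, z != b, detour c 2 a z & detour c 2 b z]) ->
  count (e x) c + count (e y) c + count U c <= size c.
Proof.
move=> c a b lc dab longU.
have weak u v : detour c 2 u v -> detour c 1 u v.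
  by case=> q [av pq sz]; exists q; split=> //; apply: ltnW.
have half1 : count (e x) (x :: t1) + count (e y) (x :: t1) + count U (x :: t1)
    <= size (x :: t1).
  apply: (chord_count_half lc dab) => z /longU[_ zb dz db]; split=> //.
  exact/weak/detour_sym.
have half2 : count (e y) (y :: t2) + count (e x) (y :: t2) + count U (y :: t2)
    <= size (y :: t2).
  have rot_c : rot (size (x :: t1)) c = (y :: t2) ++ (x :: t1).
    by rewrite rot_size_cat.
  apply: (@chord_count_half y x t2 t1).
  - by rewrite -rot_c; apply: longest_cycle_rot.
  - by rewrite -rot_c; apply/detour_rot/detour_sym.
  move=> z /longU[za _ dz db]; rewrite -rot_c; split=> //.
    exact: detour_rot.
  exact/detour_rot/weak/detour_sym.
move: half1 half2; rewrite /c !count_cat size_cat /=; lia.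
Qed.

End LongestCycle.

(** * Covering a 2-connected piece by two cycles *)

Lemma count_cards (T : finType) (P : pred T) (s : seq T) :
  uniq s -> count P s = #|[set z in s | P z]|.
Proof.
move=> us; rewrite -size_filter -(card_uniqP (filter_uniq P us)).
by apply: eq_card => z; rewrite mem_filter inE andbC.
Qed.

(** A cycle through [a] and [b] can be started at the successor of [a]; it then
    splits after [b]. *)
Lemma rot_two (T : eqType) (c : seq T) a b :
    uniq c -> a \in c -> b \in c -> a != b ->
  exists i t1 t2, [/\ rot i c = (next c a :: t1) ++ (next c b :: t2),
    last (next c a) t1 = b & last (next c b) t2 = a].
Proof.
move=> uc ac bc ab; have [i s defs] := rot_to ac.
have us : uniq (a :: s) by rewrite -defs rot_uniq.
have bs : b \in s by move: bc; rewrite -(mem_rot i) defs in_cons eq_sym (negPf ab).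
case/splitPr: bs defs us => l r defs us.
have {}defs : rot 1 (rot i c) = rcons l b ++ rcons r a.
  by rewrite defs rot1_cons rcons_cat cat_rcons.
have next_first z p q : uniq (z :: p ++ q) -> 0 < size p ->
    next (p ++ rcons q z) z = head z p.
  move=> uz; rewrite -rcons_cat -rot1_cons next_rot //.
  by case: p {uz} => //= f p _; rewrite eqxx.
have u2 : uniq (rcons l b ++ rcons r a).
  by rewrite -defs !rot_uniq.
have na : next c a = head a (rcons l b).
  rewrite -(next_rot i uc) -(next_rot 1) ?rot_uniq // defs.
  apply: next_first; last by rewrite size_rcons.
  by move: us; rewrite cat_rcons.
have nb : next c b = head b (rcons r a).
  rewrite -(next_rot i uc) -(next_rot 1) ?rot_uniq // defs.
  rewrite -(next_rot (size (rcons l b))) // rot_size_cat.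
  apply: next_first; last by rewrite size_rcons.
  have : uniq (rcons r a ++ rcons l b) by rewrite uniq_catC.
  by rewrite -rcons_cat rcons_uniq /=.
exists (rot_add c i 1), (behead (rcons l b)), (behead (rcons r a)).
rewrite -rot_rot_add defs na nb.
case: l {us defs u2 na nb} => [|l0 l]; case: r => [|r0 r];
  by rewrite /= ?last_rcons.
Qed.

Lemma independentP (T : finType) (e : rel T) (J : {set T}) :
  reflect {in J &, forall u v, ~~ e u v} (independent e J).
Proof.
apply: (iffP forall_inP) => [ind u v uJ vJ | ind u uJ].
  by have /forall_inP := ind u uJ; apply.
by apply/forall_inP => v vJ; apply: ind.
Qed.

Section TwoCycles.

Variables (T : finType) (e : rel T) (A : {set T}).
Hypotheses (e_sym : symmetric e) (e_irr : irreflexive e).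
Hypothesis A_closed : forall u v, u \in A -> e u v -> v \in A.
Hypothesis triple_sum : forall x y z, x \in A -> y \in A -> z \in A ->
  x != y -> x != z -> y != z -> ~~ e x y -> ~~ e x z -> ~~ e y z ->
  #|A| < degree e x + degree e y + degree e z.
Hypothesis indep_small : forall (J : {set T}) v,
  J \subset A -> independent e J -> v \in J ->
  #|J| + 2 <= degree e v.
Hypothesis connected2 : forall X B : {set T}, #|X| <= 1 -> X \subset A -> B \subset A ->
  [disjoint X & B] -> B != set0 -> ~~ (A \subset X :|: B) ->
  exists u v, [/\ u \in B, v \in A, v \notin X, v \notin B & e u v].

(** What a longest cycle [c] imposes on the component [K] of [u0] in [A - c].
    Here [R] collects the vertices of [A] outside both. *)
Section Outside.

Variable c : seq T.
Hypotheses (c_longest : longest_cycle e A c) (c_size : 2 < size c).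

Let cs := [set z in c].
Definition component u := [set v | connect (del e cs) u v].

Let c_uniq : uniq c.
Proof. by case: c_longest. Qed.
Let c_sub z : z \in c -> z \in A.
Proof. by case: c_longest => _ _ + _; apply. Qed.
Let next_c z : z \in c -> next c z \in c.
Proof. by rewrite mem_next. Qed.

Let next_neq a b : a != b -> next c a != next c b.
Proof. by move=> ab; rewrite (inj_eq (can_inj (prev_next c_uniq))). Qed.

Variable u0 : T.
Hypotheses (u0A : u0 \in A) (u0c : u0 \notin c).

Let K := component u0.
Let R := A :\: cs :\: K.

Let inR z : (z \in R) = [&& z \notin K, z \notin c & z \in A].
Proof. by rewrite in_setD [z \in _ :\: _]in_setD [z \in cs]in_set. Qed.

Let del_csym : connect_sym (del e cs).
Proof.
apply: sym_connect_sym => u v; rewrite /del /= e_sym.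
by rewrite andbCA.
Qed.

Let K_closed v w : v \in K -> e v w -> w \notin c -> v \notin c -> w \in K.
Proof.
rewrite !inE => cv evw wc vc; apply: connect_trans cv (connect1 _).
by rewrite /del /= !inE wc vc.
Qed.

Let K_out v : v \in K -> (v \in A) && (v \notin c).
Proof.
rewrite inE => /connectP[p]; elim: p u0 u0A u0c => [|w p IH] u uA uc /=.
  by move=> _ ->; rewrite uA uc.
case/andP=> /and3P[_]; rewrite inE => wc euw pw def_v.
exact: IH (A_closed uA euw) wc pw def_v.
Qed.

Let K_A v : v \in K -> v \in A.
Proof. by case/K_out/andP. Qed.
Let K_c v : v \in K -> v \notin c.
Proof. by case/K_out/andP. Qed.

Let u0K : u0 \in K.
Proof. by rewrite inE connect0. Qed.

Let K_step v w : v \in K -> e v w -> (w \in c) || (w \in K).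
Proof.
move=> vK evw; case: (boolP (w \in c)) => //= wc.
by apply: K_closed vK evw wc (K_c vK).
Qed.

Let K_path v w : v \in K -> w \in K ->
  exists s, [/\ path e v s, last v s = w, uniq (v :: s) & {subset v :: s <= K}].
Proof.
move=> vK wK; have : connect (del e cs) v w.
  by move: vK wK; rewrite !inE del_csym => vu /(connect_trans vu).
case/connectP=> p0 /shortenP[p pp up _] def_w.
exists p; split=> // [|z zp]; first by apply: sub_path pp => a b /and3P[].
have := path_connect pp zp; rewrite inE; apply: connect_trans.
by move: vK; rewrite inE.
Qed.

Let K_avoids s : uniq s -> {subset s <= K} -> avoids A c s.
Proof.
move=> us sK; split=> // [z /sK /K_A //|].
by apply/hasPn => z /sK /K_c.
Qed.

Let K_detour a b v w : v \in K -> w \in K -> e a v -> e b w ->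
  detour e A c (v != w).+1 a b.
Proof.
move=> vK wK eav ebw; have [s [ps ls us sK]] := K_path vK wK.
exists (v :: s); split; first exact: K_avoids.
  by rewrite /= eav rcons_path ps ls e_sym.
case: s ls {ps us sK} => [|z s] /= def_w; first by rewrite def_w eqxx.
by case: (v != w).
Qed.

Let c_split a b : a \in c -> b \in c -> a != b -> exists i t1 t2,
  [/\ rot i c = (next c a :: t1) ++ (next c b :: t2),
    last (next c a) t1 = b, last (next c b) t2 = a &
    longest_cycle e A ((next c a :: t1) ++ (next c b :: t2))].
Proof.
move=> ac bc ab; have [i [t1 [t2 [def l1 l2]]]] := rot_two c_uniq ac bc ab.
by exists i, t1, t2; split=> //; rewrite -def; apply: longest_cycle_rot.
Qed.

Let succ_K a v w : a \in c -> v \in K -> w \in K -> e a v -> ~~ e (next c a) w.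
Proof.
move=> ac vK wK eav; apply/negP => exw.
have [i s defs] := rot_to ac.
have [s' [ps ls us sK]] := K_path vK wK.
have [j [x [t [def_c lx nx]]]] : exists j x t,
    [/\ rot j c = x :: t, last x t = a & next c a = x].
  case: s defs => [|x t] defs.
    by move: c_size; rewrite -(size_rot i) defs.
  exists (rot_add c i 1), x, (rcons t a).
  rewrite -rot_rot_add defs rot1_cons last_rcons; split=> //.
  by rewrite -(next_rot i c_uniq) defs /= eqxx.
suff : v :: s' = [::] by [].
apply: (@longest_no_insertion _ e A x t).
- by rewrite -def_c; apply: longest_cycle_rot.
- by rewrite -def_c; apply/avoids_rot/K_avoids.
by rewrite lx /= eav rcons_path ps ls e_sym -nx.
Qed.

Let succ_indep a b v w : a \in c -> b \in c -> a != b -> v \in K -> w \in K ->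
  e a v -> e b w -> ~~ e (next c a) (next c b).
Proof.
move=> ac bc ab vK wK eav ebw; apply/negP => exy.
have [i [t1 [t2 [def l1 l2 lc]]]] := c_split ac bc ab.
have [q [av pq sq]] := K_detour vK wK eav ebw.
have : [::] ++ q = [::].
  apply: (longest_no_bypass e_sym lc); rewrite ?l1 ?l2 //=; last by rewrite exy.
  by rewrite -cat_cons -def; apply: avoids_rot.
by move=> /= q0; rewrite q0 in sq.
Qed.

Let succ_common a b v w r : a \in c -> b \in c -> a != b ->
  v \in K -> w \in K -> e a v -> e b w -> r \in R ->
  ~~ (e (next c a) r && e (next c b) r).
Proof.
move=> ac bc ab vK wK eav ebw rR; apply/negP => /andP[exr eyr].
have [i [t1 [t2 [def l1 l2 lc]]]] := c_split ac bc ab.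
have [s [ps ls us sK]] := K_path vK wK.
move: rR; rewrite in_setD => /andP[rK]; rewrite !inE => /andP[rc rA].
suff : [:: r] ++ (v :: s) = [::] by [].
apply: (longest_no_bypass e_sym lc).
- rewrite -def; apply: avoids_rot; split=> //.
  + by rewrite cons_uniq us andbT; apply/negP => /sK; apply/negP.
  + by move=> z; rewrite in_cons => /predU1P[->//|/sK/K_A].
  by apply/hasPn => z; rewrite in_cons => /predU1P[->//|/sK/K_c].
- by rewrite /= exr e_sym eyr.
by rewrite l1 l2 /= eav rcons_path ps ls e_sym.
Qed.

Let Nc v := [set z in c | e v z].
Let card_Nc v : count (e v) c = #|Nc v|.
Proof. exact: count_cards. Qed.

Let card_A : #|A| = size c + #|K| + #|R|.
Proof.
have sub_c : cs \subset A by apply/subsetP => z; rewrite inE => /c_sub.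
have sub_K : K \subset A :\: cs.
  by apply/subsetP => z zK; rewrite !inE (K_A zK) (K_c zK).
rewrite -(cardsID cs A) (setIidPr sub_c) -(cardsID K (A :\: cs)).
rewrite (setIidPr sub_K) addnA; congr (_ + _ + _).
by rewrite cardsE; apply/card_uniqP.
Qed.

Let degree_K v : v \in K -> degree e v = #|[set z in K | e v z]| + #|Nc v|.
Proof.
move=> vK; rewrite /degree -(cardsID cs) addnC; congr (_ + _); apply: eq_card => z.
  rewrite in_setD [z \in [set _ in K | _]]in_set [z \in cs]in_set in_set.
  have [evz|] := boolP (e v z); rewrite ?andbF //= !andbT.
  have [/K_c //|zK] := boolP (z \in K).
  by have := K_step vK evz; rewrite (negPf zK) orbF => ->.
by rewrite !inE andbC.
Qed.

Let degree_c x : x \in c -> (forall w, w \in K -> ~~ e x w) ->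
  degree e x = #|Nc x| + #|[set r in R | e x r]|.
Proof.
move=> xc xK; rewrite /degree -(cardsID cs); congr (_ + _); apply: eq_card => z.
  by rewrite !inE andbC.
rewrite in_setD [z \in cs]in_set [z \in [set _ in R | _]]in_set inR in_set.
have [exz|] := boolP (e x z); rewrite ?andbF //= !andbT.
rewrite (A_closed (c_sub xc) exz) andbT.
by have [/xK|//] := boolP (z \in K); rewrite exz.
Qed.

Let K_deg v : v \in K -> #|[set z in K | e v z]| < #|K|.
Proof.
move=> vK; apply: proper_card; apply/properP; split.
  by apply/subsetP => z; rewrite inE => /andP[].
by exists v; rewrite // inE e_irr andbF.
Qed.

(** Since [v] together with the successors of its neighbours on [c] is
    independent, the bound on independent sets leaves at least 3 neighbours of [v]
    inside [K]. *)
Let K_large v : v \in K -> 2 < #|[set z in K | e v z]|.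
Proof.
move=> vK; pose J := v |: [set next c a | a in Nc v].
have Nv a : a \in Nc v -> a \in c /\ e a v by rewrite inE e_sym => /andP.
have vJ : v \in J by rewrite setU11.
have sub_J : J \subset A.
  apply/subsetP => z /setU1P[->|/imsetP[a /Nv[ac _] ->]]; first exact: K_A.
  by apply/c_sub/next_c.
have ind_J : independent e J.
  have vs a : a \in Nc v -> ~~ e (next c a) v.
    by move=> /Nv[ac ea]; apply: (succ_K ac vK vK ea).
  apply/independentP => x y /setU1P[->|/imsetP[a aN ->]];
    move=> /setU1P[->|/imsetP[b bN ->]]; rewrite ?e_irr ?vs //.
    by rewrite e_sym vs.
  have [->|ab] := eqVneq a b; first by rewrite e_irr.
  have [[ac ea] [bc eb]] := (Nv a aN, Nv b bN).
  exact: (succ_indep ac bc ab vK vK ea eb).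
have card_J : #|J| = #|Nc v|.+1.
  rewrite cardsU1 card_imset; last exact: can_inj (prev_next c_uniq).
  suff -> : v \notin [set next c a | a in Nc v] by [].
  apply/negP => /imsetP[a /Nv[ac _] def_v].
  by have := K_c vK; rewrite def_v mem_next ac.
by have := indep_small sub_J ind_J vJ; rewrite card_J degree_K //; nat_lia.
Qed.

Let K_attached : exists a b v w,
  [/\ a \in c /\ b \in c, a != b, v \in K /\ w \in K, e a v & e b w].
Proof.
pose X := [set a in c | [exists v in K, e a v]].
have [lt1X | X_le1] := ltnP 1 #|X|.
  have [a [b [aX bX ab]]] : exists a b, [/\ a \in X, b \in X & a != b].
    by case/card_gt1P: lt1X => a [b [aX bX ab]]; exists a, b.
  move: aX bX; rewrite !inE => /andP[ac /exists_inP[v vK eav]].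
  by case/andP=> [bc /exists_inP[w wK ebw]]; exists a, b, v, w.
have sub_K : K \subset A by apply/subsetP => z; apply: K_A.
have disXK : [disjoint X & K].
  apply/pred0P => z /=; rewrite inE; apply/negP => /andP[/andP[zc _] /K_c].
  by rewrite zc.
have K_n0 : K != set0 by apply/set0Pn; exists u0.
have sub_X : X \subset A by apply/subsetP => z; rewrite inE => /andP[/c_sub].
have nsub : ~~ (A \subset X :|: K).
  apply/negP => /subsetP sA; have : cs \subset X.
    apply/subsetP => z; rewrite inE => zc; have := sA z (c_sub zc).
    by rewrite in_setU => /orP[//|/K_c]; rewrite zc.
  move/subset_leq_card; rewrite cardsE (card_uniqP c_uniq); nat_lia.
have [u [v [uK vA vX vK euv]]] := connected2 X_le1 sub_X sub_K disXK K_n0 nsub.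
have := K_step uK euv; rewrite (negPf vK) orbF => vc.
by case/negP: vX; rewrite inE vc /=; apply/exists_inP; exists u; rewrite // e_sym.
Qed.

(** The successors of [a] and [b] form an independent triple with [u], which gives
    the first bound; the second one is [chord_count]. *)
Let main_sum a b v w u (U : {set T}) : a \in c -> b \in c -> a != b ->
    v \in K -> w \in K -> e a v -> e b w -> u \in K -> U \subset cs ->
    (forall z, z \in U ->
       [/\ z != a, z != b, detour e A c 2 a z & detour e A c 2 b z]) ->
  [/\ #|A| < degree e u + degree e (next c a) + degree e (next c b),
      #|Nc (next c a)| + #|Nc (next c b)| + #|U| <= size c,
      degree e (next c a) = #|Nc (next c a)| + #|[set r in R | e (next c a) r]|
    & degree e (next c b) = #|Nc (next c b)| + #|[set r in R | e (next c b) r]|].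
Proof.
move=> ac bc ab vK wK eav ebw uK sU longU.
have xK z : z \in K -> ~~ e (next c a) z by move=> zK; apply: (succ_K ac vK zK eav).
have yK z : z \in K -> ~~ e (next c b) z by move=> zK; apply: (succ_K bc wK zK ebw).
have xc := next_c ac; have yc := next_c bc.
split; [| | exact: degree_c | exact: degree_c].
  apply: triple_sum.
  - exact: K_A.
  - exact: c_sub.
  - exact: c_sub.
  - by apply: contraTneq xc => <-; apply: K_c.
  - by apply: contraTneq yc => <-; apply: K_c.
  - exact: next_neq.
  - by rewrite e_sym xK.
  - by rewrite e_sym yK.
  exact: (succ_indep ac bc ab vK wK eav ebw).
have [i [t1 [t2 [def l1 l2 lc]]]] := c_split ac bc ab.
have -> : #|U| = count (mem U) c.
  rewrite count_cards //; apply: eq_card => z; rewrite inE.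
  apply/idP/andP => [zU | [] //]; split=> //.
  by have := subsetP sU z zU; rewrite inE.
rewrite -!card_Nc.
have pr : perm_eq ((next c a :: t1) ++ (next c b :: t2)) c.
  by rewrite -def perm_rot.
rewrite -!(permP pr) -(perm_size pr).
apply: (chord_count e_sym e_irr lc) => [|z zU]; rewrite l1 l2 -def.
  apply: detour_rot; have [q [av pq sq]] := K_detour vK wK eav ebw.
  by exists q; split=> //; apply: leq_trans sq.
have [za zb daz dbz] := longU z zU; split=> //; exact: detour_rot.
Qed.

(** A common neighbour in [R] of the two successors would bypass the cycle
    through [K], so their neighbourhoods in [R] are disjoint; if they fill [R],
    then each vertex of [R] lies in exactly one. *)
Let R_disjoint a b v w : a \in c -> b \in c -> a != b ->
    v \in K -> w \in K -> e a v -> e b w ->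
  let X := [set r in R | e (next c a) r] in
  let Y := [set r in R | e (next c b) r] in
  #|X| + #|Y| <= #|R| /\
  (#|R| <= #|X| + #|Y| -> forall r, r \in R -> e (next c a) r != e (next c b) r).
Proof.
move=> ac bc ab vK wK eav ebw X Y.
have dis r : r \in R -> ~~ (e (next c a) r && e (next c b) r).
  exact: (succ_common ac bc ab vK wK eav ebw).
have inX r : (r \in X) = (r \in R) && e (next c a) r by rewrite [_ \in X]in_set.
have inY r : (r \in Y) = (r \in R) && e (next c b) r by rewrite [_ \in Y]in_set.
have XY0 : #|X :&: Y| = 0.
  apply/eqP; rewrite cards_eq0; apply/set0Pn => -[r].
  rewrite in_setI inX inY => /andP[/andP[rR ex] /andP[_ ey]].
  by have := dis r rR; rewrite ex ey.
have sub : X :|: Y \subset R.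
  by apply/subsetP => r; rewrite in_setU inX inY -andb_orr => /andP[].
rewrite -cardsUI XY0 addn0; split; first exact: subset_leq_card.
move=> le_R r rR; have /eqP eqR : X :|: Y == R by rewrite eqEcard sub.
have := dis r rR; move: (rR); rewrite -eqR in_setU inX inY rR /=.
by case: (e _ r); case: (e _ r).
Qed.

(** With at most one neighbour on [c], the degree of [u] is at most [|K|], and
    [main_sum] with an empty [U] already gives a degree sum of at most [|A|]. *)
Let Nc_gt1 u : u \in K -> 1 < #|Nc u|.
Proof.
move=> uK; have [a [b [v [w [[ac bc] ab [vK wK] eav ebw]]]]] := K_attached.
have no_z z : z \in set0 ->
    [/\ z != a, z != b, detour e A c 2 a z & detour e A c 2 b z].
  by rewrite inE.
have [sum cnt dx dy] :=
  main_sum ac bc ab vK wK eav ebw uK (sub0set cs) no_z.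
have [leR _] := R_disjoint ac bc ab vK wK eav ebw.
move: sum cnt; rewrite dx dy (degree_K uK) card_A cards0.
have := K_deg uK; nat_lia.
Qed.

(** Apply [main_sum] at two neighbours [a], [b] of [v], with [U] the neighbours of
    [u] on [c] other than [a] and [b]: the detours from [a] and [b] to [U] run
    through [v] and [u], hence are long.  The resulting upper bound on the degree
    sum is [|A| + 1], so all estimates used are equalities. *)
Let tight u v a b : u \in K -> v \in K -> u != v ->
    a \in Nc v -> b \in Nc v -> a != b ->
  [/\ #|[set z in K | e u z]|.+1 = #|K|, a \in Nc u, b \in Nc u &
      forall r, r \in R -> e (next c a) r != e (next c b) r].
Proof.
move=> uK vK uv aN bN ab.
have [[ac eav] [bc ebv]] : (a \in c /\ e a v) /\ (b \in c /\ e b v).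
  by move: aN bN; rewrite !inE ![e v _]e_sym => /andP[-> ->] /andP[-> ->].
pose U := Nc u :\: [set a; b].
have sub_U : U \subset cs.
  by apply/subsetP => z; rewrite !inE => /andP[_ /andP[]].
have long z : z \in U ->
    [/\ z != a, z != b, detour e A c 2 a z & detour e A c 2 b z].
  rewrite !inE negb_or => /andP[/andP[za zb] /andP[zc euz]]; split=> //.
    by have := K_detour vK uK eav (etrans (e_sym z u) euz); rewrite eq_sym uv.
  by have := K_detour vK uK ebv (etrans (e_sym z u) euz); rewrite eq_sym uv.
have [sum cnt dx dy] := main_sum ac bc ab vK vK eav ebv uK sub_U long.
have [leR eqR] := R_disjoint ac bc ab vK vK eav ebv.
have defN := cardsID [set a; b] (Nc u); rewrite -/U in defN.
have le2 : #|Nc u :&: [set a; b]| <= #|[set a; b]|.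
  by apply: subset_leq_card; apply: subsetIr.
have c2 : #|[set a; b]| = 2 by rewrite cards2 ab.
have Kd := K_deg uK.
move: sum cnt; rewrite dx dy (degree_K uK) card_A => sum cnt.
have sub_ab : [set a; b] \subset Nc u.
  have /eqP <- : Nc u :&: [set a; b] == [set a; b].
    rewrite eqEcard subsetIr; nat_lia.
  exact: subsetIl.
split; [nat_lia | | | apply: eqR; nat_lia].
  by apply: (subsetP sub_ab); rewrite set21.
by apply: (subsetP sub_ab); rewrite set22.
Qed.

Let K_other v : v \in K -> exists2 u, u \in K & u != v.
Proof.
move=> vK; have := K_large vK; have := K_deg vK.
rewrite [#|K|](cardsD1 v) vK => lt1 lt2.
have /card_gt0P[u] : 0 < #|K :\ v| by nat_lia.
by rewrite in_setD1 => /andP[uv uK]; exists u.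
Qed.

Let Nc_sub u v : u \in K -> v \in K -> Nc v \subset Nc u.
Proof.
move=> uK vK; have [-> //|uv] := eqVneq u v.
have /card_gt1P[a [b [aN bN ab]]] := Nc_gt1 vK.
apply/subsetP => z zN; have [za|az] := eqVneq a z.
  by have [_ + _ _] := tight uK vK uv aN bN ab; rewrite za.
by have [_ _ + _] := tight uK vK uv aN zN az.
Qed.

(** By [K_large] every vertex of [K] belongs to a pair of distinct vertices of
    [K], so [tight] applies at every vertex. *)
Lemma outside_component :
  [/\ 2 < #|K|, forall v w, v \in K -> w \in K -> v != w -> e v w,
      forall v, v \in K -> v \in A /\ v \notin c,
      forall v z, v \in K -> z \in c -> e v z = e u0 z &
   [/\ forall v, v \in K -> (degree e v).+1 = #|K| + #|Nc u0|,
       1 < #|Nc u0|,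
       forall a v, a \in Nc u0 -> v \in K -> ~~ e (next c a) v,
       forall a b, a \in Nc u0 -> b \in Nc u0 -> a != b ->
         ~~ e (next c a) (next c b) &
       forall a b, a \in Nc u0 -> b \in Nc u0 -> a != b ->
         forall r, r \in A -> r \notin c -> r \notin K ->
         e (next c a) r != e (next c b) r]].
Proof.
have eqN v w : v \in K -> w \in K -> Nc v = Nc w.
  by move=> vK wK; apply/eqP; rewrite eqEsubset !Nc_sub.
have NP a : a \in Nc u0 -> a \in c /\ e a u0 by rewrite inE e_sym => /andP.
have dK v : v \in K -> #|[set z in K | e v z]|.+1 = #|K|.
  move=> vK; have [u uK uv] := K_other vK.
  have /card_gt1P[a [b [aN bN ab]]] := Nc_gt1 uK.
  by rewrite eq_sym in uv; have [] := tight vK uK uv aN bN ab.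
split; [| | by move=> v /K_out/andP | | split=> //].
- by have := K_deg u0K; have := K_large u0K; nat_lia.
- move=> v w vK wK vw; have sub : [set z in K | e v z] \subset K :\ v.
    apply/subsetP => z; rewrite [z \in [set _ in K | _]]in_set in_setD1.
    case/andP=> -> evz; rewrite andbT.
    by apply: contraTneq evz => ->; rewrite e_irr.
  have /eqP defK : [set z in K | e v z] == K :\ v.
    by rewrite eqEcard sub; have := dK v vK; rewrite [#|K|](cardsD1 v) vK; nat_lia.
  have : w \in K :\ v by rewrite in_setD1 eq_sym vw.
  by rewrite -defK [w \in _]in_set => /andP[].
- move=> v z vK zc; have /setP/(_ z) := eqN v u0 vK u0K.
  by rewrite !inE zc.
- by move=> v vK; rewrite (degree_K vK) (eqN v u0) // -addSn dK.
- exact: Nc_gt1.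
- by move=> a v /NP[ac ea] vK; apply: succ_K u0K vK ea.
- by move=> a b /NP[ac ea] /NP[bc eb] ab; apply: (succ_indep ac bc ab u0K u0K).
move=> a b aN bN ab r rA rc rK.
have [u uK uu0] := K_other u0K.
have [_ _ _] := tight uK u0K uu0 aN bN ab; apply.
by rewrite inR rK rc.
Qed.

End Outside.

Lemma connect_del_sym (S : {set T}) : connect_sym (del e S).
Proof.
apply: sym_connect_sym => u v; rewrite /del /= e_sym.
by rewrite andbCA.
Qed.

(** All degrees are at least 3.  Extend a path at its first vertex [x] as long as
    possible: in the end all neighbours of [x] lie on the path, and the edge to a
    neighbour other than the second vertex closes a cycle. *)
Lemma exists_cycle v : v \in A ->
  exists c, [/\ cycle e c, uniq c, {subset c <= A} & 2 < size c].
Proof.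
move=> vA; have deg3 w : w \in A -> 2 < degree e w.
  move=> wA; have := @indep_small [set w] w; rewrite cards1 inE sub1set wA.
  apply=> //; apply/independentP => x y /set1P-> /set1P->.
  by rewrite e_irr.
suff grow n x s : path e x s -> uniq (x :: s) -> {subset x :: s <= A} ->
    #|T| <= size s + n ->
    exists c, [/\ cycle e c, uniq c, {subset c <= A} & 2 < size c].
  by apply: (grow #|T| v [::]) => // z; rewrite inE => /eqP->.
elim: n x s => [|n IH] x s px us sA sz.
  have := max_card (mem (x :: s)); rewrite (card_uniqP us) /=.
  by rewrite addn0 in sz; move=> /leq_trans/(_ sz); rewrite ltnn.
have [sub | /subsetPn[w]] := boolP ([set w | e x w] \subset x :: s); last first.
  rewrite inE => exw ws; apply: (IH w (x :: s)).
  - by rewrite /= e_sym exw.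
  - by rewrite cons_uniq ws.
  - move=> z; rewrite in_cons => /predU1P[->|/sA//].
    by apply: A_closed exw; apply: sA; apply: mem_head.
  by rewrite /= addSnnS.
have xA : x \in A by apply: sA; apply: mem_head.
have nbr w : e x w -> w \in s.
  move=> exw; have := subsetP sub w; rewrite inE exw in_cons => /(_ isT).
  by case/predU1P=> // wx; rewrite wx e_irr in exw.
case: s px us sA nbr {sz sub IH} => [|f s] px us sA nbr.
  by have := deg3 x xA; rewrite /degree eq_card0 // => w; rewrite inE; apply/negP => /nbr.
have [w exw wf] : exists2 w, e x w & w != f.
  have := deg3 x xA; rewrite /degree (cardsD1 f) => d3.
  have /card_gt0P[w] : 0 < #|[set u | e x u] :\ f|.
    by move: d3; case: (f \in _); nat_lia.
  by rewrite !inE => /andP[wf exw]; exists w.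
have ws : w \in s by have := nbr w exw; rewrite in_cons (negPf wf).
case/splitPr: ws px us sA {nbr} => l r px us sA.
have cut : (x :: f :: rcons l w) ++ r = x :: f :: l ++ w :: r.
  by rewrite /= cat_rcons.
exists (x :: f :: rcons l w); split.
- move: px; rewrite /= cat_path /= !rcons_path last_rcons [e w x]e_sym exw.
  by case/and4P=> -> -> -> _.
- by move: us; rewrite -cut cat_uniq => /andP[].
- by move=> z zl; apply: sA; rewrite -cut mem_cat zl.
by rewrite /= size_rcons.
Qed.

Lemma exists_longest_cycle v : v \in A ->
  exists2 c, longest_cycle e A c & 2 < size c.
Proof.
move=> vA; have [c0 [cyc0 uc0 sc0 sz0]] := exists_cycle vA.
pose P n := [exists c : n.-tuple T, [&& cycle e c, uniq c & all (mem A) c]].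
have toP c : cycle e c -> uniq c -> {subset c <= A} -> P (size c).
  by move=> cc uc /allP sc; apply/existsP; exists (in_tuple c); rewrite cc uc.
have exP : exists n, P n by exists (size c0); apply: toP.
have ubP n : P n -> n <= #|T|.
  case/existsP=> c /and3P[_ uc _]; rewrite -[n in n <= _](size_tuple c).
  by rewrite -(card_uniqP uc) max_card.
case: (ex_maxnP exP ubP) => n /existsP[c /and3P[cc uc /allP sc]] maxn.
exists c; last first.
  by rewrite size_tuple; apply: leq_trans sz0 _; apply/maxn/toP.
by split=> // L uL cL sL; rewrite size_tuple; apply/maxn/toP.
Qed.

Lemma next_neq (c : seq T) v : uniq c -> 2 < size c -> v \in c -> next c v != v.
Proof.
move=> uc sc vc; apply: contra_neq (next_neq_prev uc sc vc) => nv.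
by rewrite -{2}nv prev_next.
Qed.

Lemma complete_cycle (c : seq T) : uniq c -> 2 < size c ->
  {in c &, forall v w, v != w -> e v w} -> cycle e c.
Proof.
move=> uc sc complete; apply: cycle_from_next => // v vc.
by apply: complete; rewrite ?mem_next // eq_sym next_neq.
Qed.

(** Suppose that [u] and [r] lie in different components of [A - c].  By the
    alternative in [outside_component], three neighbours of [u] on [c] would have
    successors of which every two differ in adjacency to [r]; so [u], and likewise
    [r], has exactly two neighbours on [c].  One of the two successors for [u],
    say [y], is not adjacent to [r]; it then misses both components, itself and
    the other successor, and the triple [u], [r], [y] has degree sum at most
    [|A|]. *)
Lemma longest_cycle_two_components c u r : longest_cycle e A c -> 2 < size c ->
  u \in A -> u \notin c -> r \in A -> r \notin c -> r \in component c u.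
Proof.
move=> lc sc uA uc rA rc; apply/negPn/negP => rK.
have dcs := connect_del_sym [set z in c].
have inK v w : (w \in component c v) = connect (del e [set z in c]) v w.
  by rewrite inE.
have uK : u \notin component c r by rewrite inK dcs -inK.
have two v w : v \in A -> v \notin c -> w \in A -> w \notin c ->
    w \notin component c v -> #|[set z in c | e v z]| = 2.
  move=> vA vc wA wc wK.
  have [_ _ _ _ [_ gt1 _ _ xor]] := outside_component lc sc vA vc.
  apply/eqP; rewrite eqn_leq gt1 andbT leqNgt; apply/negP => /card_gt2P.
  case=> x [y [z [[xN yN zN] [xy yz zx]]]].
  have := (xor _ _ xN yN xy _ wA wc wK, xor _ _ yN zN yz _ wA wc wK,
           xor _ _ zN xN zx _ wA wc wK).
  by case: (e _ w) => -[[]]; case: (e _ w); case: (e _ w).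
have Nu := two u r uA uc rA rc rK; have Nr := two r u rA rc uA uc uK.
have [_ _ outu _ [degu gt1 nadj indep xor]] := outside_component lc sc uA uc.
have [_ _ outr nbrr [degr _ _ _ _]] := outside_component lc sc rA rc.
have [p [q [pN qN pq nadjr]]] : exists p q, [/\ p \in [set z in c | e u z],
    q \in [set z in c | e u z], p != q & ~~ e (next c p) r].
  case/card_gt1P: gt1 => a [b [aN bN ab]].
  have [ear|nar] := boolP (e (next c a) r); last by exists a, b.
  exists b, a; rewrite eq_sym; split=> //.
  by have := xor a b aN bN ab r rA rc rK; rewrite ear; case: (e _ r).
set y := next c p in nadjr.
have pc : p \in c by move: pN; rewrite inE => /andP[].
have qc : q \in c by move: qN; rewrite inE => /andP[].
have yc : y \in c by rewrite mem_next.
have xc : next c q \in c by rewrite mem_next.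
have [_ c_uniq c_sub _] := lc.
have uu : u \in component c u by rewrite inE connect0.
have rr : r \in component c r by rewrite inE connect0.
have neur : u != r by apply: contraNneq rK => <-.
have nur : ~~ e u r.
  apply: contra rK => eur; rewrite inE; apply: connect1.
  by rewrite /del /= !inE uc rc.
have sum : #|A| < degree e u + degree e r + degree e y.
  apply: triple_sum => //; first exact: c_sub.
  - by apply: contraNneq uc => ->.
  - by apply: contraNneq rc => ->.
  - by rewrite e_sym nadj.
  by rewrite e_sym.
pose N := [set w | e y w].
pose Z := component c u :|: component c r :|: [set y; next c q].
have disK : [disjoint component c u & component c r].
  apply/pred0P => z /=; rewrite !inE; apply/negP => /andP[uz rz].
  by case/negP: rK; rewrite inE; apply: connect_trans uz _; rewrite dcs.
have disY : [disjoint component c u :|: component c r & [set y; next c q]].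
  apply/pred0P => z /=; apply/negP => /andP[]; rewrite in_setU in_set2.
  by case/orP=> [/outu|/outr] [_ zc] /orP[]/eqP zy; rewrite zy ?yc ?xc in zc.
have neyx : y != next c q.
  by rewrite (inj_eq (can_inj (prev_next c_uniq))).
have cardZ : #|Z| = #|component c u| + #|component c r| + 2.
  rewrite cardsU (disjoint_setI0 disY) cards0 subn0.
  by rewrite cardsU (disjoint_setI0 disK) cards0 subn0 cards2 neyx.
have disN : [disjoint N & Z].
  apply/pred0P => z /=; apply/negP => /andP[]; rewrite in_set => eyz.
  rewrite !in_setU !in_set1 -!orbA => /or4P[zu|zr|/eqP zy|/eqP zy].
  - by have := nadj p z pN zu; rewrite -/y eyz.
  - by case/negP: nadjr; rewrite e_sym -(nbrr z y zr yc) e_sym.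
  - by rewrite zy e_irr in eyz.
  by have := indep p q pN qN pq; rewrite -/y -zy eyz.
have sub : N :|: Z \subset A.
  apply/subsetP => z; rewrite in_setU => /orP[|].
    by rewrite in_set => /(A_closed (c_sub _ yc)).
  rewrite !in_setU !in_set1 -!orbA.
  by case/or4P=> [/outu[]//|/outr[]//|/eqP->|/eqP->]; apply: c_sub.
have := subset_leq_card sub; rewrite cardsU (disjoint_setI0 disN) cards0 subn0.
have := (degu u uu, degr r rr); rewrite Nu Nr cardZ => -[du dr].
have dy : degree e y = #|N| by [].
move: sum; rewrite dy; nat_lia.
Qed.

(** Either [c] is Hamiltonian in [A], or [A - c] is a single complete component
    with at least 3 vertices. *)
Lemma two_cycles v : v \in A -> cycle_cover e A 2.
Proof.
move=> vA; have [c lc sc] := exists_longest_cycle vA.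
have [cc uc sub_c _] := lc.
have cover_c : cycle_cover e [set z in c] 1.
  by apply: (cycle_cover1 cc sc uc) => z; rewrite inE.
have [/subsetP sub_A | /subsetPn[u uA uNc]] := boolP (A \subset c).
  have -> : A = [set z in c].
    by apply/setP => z; rewrite inE; apply/idP/idP; [apply: sub_A | apply: sub_c].
  exact: cycle_cover_le cover_c.
have [K2 K_complete K_out _ _] := outside_component lc sc uA uNc.
have -> : A = [set z in c] :|: component c u.
  apply/setP => z; rewrite in_setU [z \in [set _ in c]]in_set; apply/idP/idP.
    move=> zA; have [//|zc] := boolP (z \in c).
    exact: longest_cycle_two_components.
  by case/orP=> [/sub_c//|/K_out[]].
rewrite -[2]/(1 + 1); apply: cycle_coverU cover_c _.
  apply/pred0P => z /=; rewrite [z \in [set _ in c]]in_set; apply/negP.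
  by case/andP=> zc /K_out[_]; rewrite zc.
apply: (@cycle_cover1 _ _ _ (enum (component c u))); rewrite -?cardE ?enum_uniq //.
- apply: complete_cycle; rewrite -?cardE ?enum_uniq // => x y.
  by rewrite !mem_enum; apply: K_complete.
by move=> z; rewrite mem_enum.
Qed.

End TwoCycles.

(** * Hamiltonian pieces *)

Section OreCovers.

Variables (T : finType) (e : rel T).
Hypotheses (e_sym : symmetric e) (e_irr : irreflexive e).

Lemma cover_of_closure (A : {set T}) (e' : rel T) L :
    symmetric e' -> subrel e e' -> cycle e' L -> uniq L -> L =i A -> 2 < #|A| ->
    {in A &, forall u v, e' u v -> ~~ e u v ->
       #|A| <= #|[set z in A | e u z]| + #|[set z in A | e v z]|} ->
  cycle_cover e A 1.
Proof.
move=> e'_sym ee' cL uL LA A2 ore.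
have szL : size L = #|A| by rewrite -(card_uniqP uL); apply: eq_card.
have cnt u : count (e u) L = #|[set z in A | e u z]|.
  by rewrite count_cards //; apply: eq_card => z; rewrite !inE LA.
have [|M pM cM] := ore_closure e_sym e_irr e'_sym ee' cL uL.
  by move=> u v; rewrite !LA szL !cnt; apply: ore.
apply: (cycle_cover1 cM); rewrite ?(perm_size pM) ?szL //.
  by rewrite (perm_uniq pM).
by move=> z; rewrite (perm_mem pM) LA.
Qed.

(** Ore's theorem inside [A], starting from an arbitrary cyclic order. *)
Lemma ore_cover (A : {set T}) : 2 < #|A| ->
    {in A &, forall u v, u != v -> ~~ e u v ->
       #|A| <= #|[set z in A | e u z]| + #|[set z in A | e v z]|} ->
  cycle_cover e A 1.
Proof.
move=> A2; apply: (@cover_of_closure A (fun u v => u != v) (enum A)).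
- by move=> u v; rewrite eq_sym.
- by move=> u v euv; apply: contraTneq euv => ->; rewrite e_irr.
- apply: cycle_from_next; rewrite ?enum_uniq // => v vA.
  by rewrite eq_sym next_neq ?enum_uniq // -cardE.
- exact: enum_uniq.
- by move=> z; rewrite mem_enum.
by [].
Qed.

(** The degree condition concerns pairs of [A] only; starting from a cyclic order
    in which [x] stands between its neighbours [y] and [z], all missing edges are
    pairs of [A]. *)
Lemma ore_cover_add (A : {set T}) x y z :
    x \notin A -> y \in A -> z \in A -> y != z -> e x y -> e x z ->
    {in A &, forall u v, u != v -> ~~ e u v ->
       #|A| < #|[set w in x |: A | e u w]| + #|[set w in x |: A | e v w]|} ->
  cycle_cover e (x |: A) 1.
Proof.
move=> xA yA zA yz exy exz ore.
pose e' u v := e u v || [&& u != x, v != x & u != v].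
pose s := enum (A :\ y :\ z).
have mem_s w : (w \in y :: rcons s z) = (w \in A).
  rewrite in_cons mem_rcons in_cons mem_enum !in_setD1.
  have [->|wy] := eqVneq w y; first by rewrite yA.
  by have [->|wz] := eqVneq w z; rewrite ?zA.
have us : uniq (x :: y :: rcons s z).
  rewrite cons_uniq mem_s xA cons_uniq rcons_uniq enum_uniq mem_rcons in_cons.
  by rewrite !mem_enum !in_setD1 !eqxx (negPf yz) andbF.
apply: (@cover_of_closure (x |: A) e' (x :: y :: rcons s z)) => //.
- move=> u v; rewrite /e' e_sym; congr (_ || _).
  by rewrite andbCA [u == v]eq_sym.
- by move=> u v euv; rewrite /e' euv.
- rewrite /= rcons_path last_rcons /e' exy [e z x]e_sym exz /= andbT.
  have : pairwise (fun u v => u != v) (y :: rcons s z).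
    by rewrite -uniq_pairwise; move: us => /= /andP[].
  move/pairwise_sorted; rewrite /=.
  have : all (fun u => u != x) (y :: rcons s z).
    apply/allP => w wl; move: us => /= /andP[xl _].
    by apply: contraNneq xl => <-.
  apply: sub_in_path => u v; rewrite /in_mem /= => ux vx uv.
  by rewrite ux vx uv orbT.
- by move=> w; rewrite in_cons mem_s in_setU1.
- rewrite cardsU1 xA; have : #|[set y; z]| <= #|A|.
    by apply: subset_leq_card; apply/subsetP => w; rewrite !inE => /orP[]/eqP->.
  by rewrite cards2 yz.
move=> u v; rewrite !in_setU1 cardsU1 xA => uA vA.
rewrite /e' => /orP[->//|/and3P[ux vx uv]] nuv.
by apply: ore => //; [move: uA; rewrite (negPf ux) | move: vA; rewrite (negPf vx)].
Qed.

End OreCovers.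

(** * Pieces left by a separator *)

Lemma subset_of_card (T : finType) (A : {set T}) n :
  n <= #|A| -> exists2 B : {set T}, B \subset A & #|B| = n.
Proof.
case/card_geqP=> s [us <- sA]; exists [set z in s].
  by apply/subsetP => z; rewrite inE => /sA.
by rewrite cardsE; apply/card_uniqP.
Qed.

Lemma sum_disjointU (T : finType) (A B : {set T}) (F : T -> nat) :
  [disjoint A & B] ->
  \sum_(v in A :|: B) F v = \sum_(v in A) F v + \sum_(v in B) F v.
Proof.
move=> dAB; rewrite -bigU //=; apply: eq_bigl => v.
by rewrite in_setU.
Qed.

Lemma fin_forall_or (I : finType) (P Q : I -> Prop) :
  (forall i, P i \/ Q i) -> (forall i, P i) \/ exists i, Q i.
Proof.
move=> PQ; suff : forall s : seq I, (forall i, i \in s -> P i) \/ exists i, Q i.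
  by case/(_ (enum I)) => [all_P | ]; [left=> i; apply: all_P; rewrite mem_enum | right].
elim=> [|i s [IH|]]; [by left | | by right].
have [Pi|Qi] := PQ i; last by right; exists i.
by left=> j; rewrite in_cons => /predU1P[->|/IH].
Qed.

Lemma independentU (T : finType) (e : rel T) (P Q : {set T}) : symmetric e ->
    independent e P -> independent e Q -> {in P & Q, forall u v, ~~ e u v} ->
  independent e (P :|: Q).
Proof.
move=> e_sym /independentP iP /independentP iQ PQ; apply/independentP => u v.
rewrite !in_setU => /orP[uP|uQ] /orP[vP|vQ]; [exact: iP | exact: PQ | | exact: iQ].
by rewrite e_sym; apply: PQ.
Qed.

Lemma independent2 (T : finType) (e : rel T) u v :
  symmetric e -> irreflexive e -> ~~ e u v -> independent e [set u; v].
Proof.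
move=> e_sym e_irr nuv; apply/independentP => x y /set2P[]-> /set2P[]->;
  by rewrite ?e_irr // e_sym.
Qed.

Section Parts.

Variables (T : finType) (e : rel T) (k : nat).
Hypotheses (e_sym : symmetric e) (e_irr : irreflexive e) (k_gt0 : 0 < k).
Hypothesis degree_sum : forall J : {set T}, independent e J -> #|J| = k.+1 ->
  #|T| <= \sum_(v in J) degree e v.
Hypothesis indep_lt : forall (J : {set T}) v, independent e J -> v \in J ->
  #|J| < degree e v.

Section Separation.

Variables (I : finType) (S : {set T}) (lab : T -> I).

Definition part i := [set v | (v \notin S) && (lab v == i)].

Definition separates := (forall i, exists v, v \in part i) /\
  (forall u v, u \notin S -> v \notin S -> e u v -> lab u = lab v).

Hypothesis sep : separates.

(** The number of vertices that could be neighbours of [v], since no edge joins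
    two parts, but are not. *)
Definition missed v := #|[set u in part (lab v) :|: S | (u != v) && ~~ e v u]|.

Let partE v i : (v \in part i) = (v \notin S) && (lab v == i).
Proof. by rewrite inE. Qed.

Let part_lab v i : v \in part i -> lab v = i.
Proof. by rewrite partE => /andP[_ /eqP]. Qed.

Let part_out v i : v \in part i -> v \notin S.
Proof. by rewrite partE => /andP[]. Qed.

Lemma part_neighbor v i u : v \in part i -> e v u -> (u \in part i) || (u \in S).
Proof.
case: sep => _ edges vi evu; have [//|uS] := boolP (u \in S); rewrite ?orbT //.
by rewrite orbF partE uS -(edges _ _ (part_out vi) uS evu) (part_lab vi) eqxx.
Qed.

Lemma disjoint_parts i j : i != j -> [disjoint part i & part j].
Proof.
move=> ij; apply/pred0P => v /=; apply/negP => /andP[/part_lab vi /part_lab vj].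
by rewrite -vi -vj eqxx in ij.
Qed.

Lemma card_parts (N : {set T}) : #|N| = #|N :&: S| + \sum_i #|N :&: part i|.
Proof.
rewrite -(cardsID S N); congr (_ + _).
rewrite -sum1_card (partition_big lab predT) //=.
apply: eq_bigr => i _; rewrite -sum1_card; apply: eq_bigl => v.
by rewrite !inE; case: (v \in N); rewrite ?andbF //= andbT.
Qed.

Lemma card_all_parts : #|T| = #|S| + \sum_i #|part i|.
Proof.
rewrite -cardsT card_parts setTI; congr (_ + _).
by apply: eq_bigr => i _; rewrite setTI.
Qed.

Definition inner_degree i v := #|[set z in part i | e v z]|.

Lemma degree_inner v i : v \in part i ->
  degree e v = inner_degree i v + #|[set z in S | e v z]|.
Proof.
move=> vi; rewrite /degree -(cardsID S) addnC; congr (_ + _); apply: eq_card => u.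
  rewrite in_setD [u \in [set _ | _]]in_set [u \in [set _ in part i | _]]in_set.
  have [evu|] := boolP (e v u); rewrite ?andbF //= !andbT.
  have := part_neighbor vi evu; have [ui _|_ /= ->//] := boolP (u \in part i).
  by rewrite (part_out ui).
by rewrite !inE andbC.
Qed.

Lemma degree_missed v i : v \in part i ->
  degree e v + missed v + 1 = #|part i| + #|S|.
Proof.
move=> vi; have dPS : [disjoint part i & S].
  by apply/pred0P => u /=; apply/negP => /andP[/part_out/negP].
have -> : #|part i| + #|S| = #|part i :|: S|.
  by rewrite cardsU (disjoint_setI0 dPS) cards0 subn0.
rewrite /missed (part_lab vi) -(cardsID [set u | e v u] (part i :|: S)) -addnA.
have -> : (part i :|: S) :&: [set u | e v u] = [set u | e v u].
  apply/setIidPr/subsetP => u; rewrite inE in_setU; exact: part_neighbor.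
congr (_ + _); rewrite [RHS](cardsD1 v) addnC; congr (_ + _).
  by rewrite in_setD in_setU vi inE e_irr.
apply: eq_card => u; rewrite [LHS]in_set in_setD1 in_setD [u \in [set _ | e v _]]in_set.
by rewrite andbCA; congr (_ && _); rewrite andbC.
Qed.

Definition transversal (w : I -> T) := forall i, w i \in part i.

Lemma transversal_through v i : v \in part i ->
  exists2 w, transversal w & w i = v.
Proof.
move=> vi; have [w0 w0P] := fin_all_exists (proj1 sep).
exists (fun j => if j == i then v else w0 j); last by rewrite eqxx.
by move=> j; case: eqP => [->|].
Qed.

Lemma transversal_inj w : transversal w -> injective w.
Proof. by move=> wP i j wij; rewrite -(part_lab (wP i)) wij (part_lab (wP j)). Qed.

Lemma independent_transversal (P : {set T}) (J : {set I}) w :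
    transversal w -> independent e P ->
    {in P & J, forall v j, (v != w j) && ~~ e v (w j)} ->
  [/\ independent e (P :|: w @: J), #|P :|: w @: J| = #|P| + #|J| &
      \sum_(v in P :|: w @: J) degree e v =
      \sum_(v in P) degree e v + \sum_(j in J) degree e (w j)].
Proof.
move=> wP /independentP indP far; have winj := transversal_inj wP.
have dis : [disjoint P & w @: J].
  apply/pred0P => v /=; apply/negP => /andP[vP /imsetP[j jJ vw]].
  by have := far v j vP jJ; rewrite vw eqxx.
split.
- apply/independentP => u v; rewrite !in_setU.
  case/orP=> [uP|/imsetP[i iJ ->]] /orP[vP|/imsetP[j jJ ->]].
  + exact: indP.
  + by case/andP: (far u j uP jJ).
  + by rewrite e_sym; case/andP: (far v i vP iJ).
  apply/negP => eij; have := proj2 sep _ _ (part_out (wP i)) (part_out (wP j)) eij.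
  by rewrite (part_lab (wP i)) (part_lab (wP j)) => ij; rewrite ij e_irr in eij.
- by rewrite cardsU (disjoint_setI0 dis) cards0 subn0 card_imset.
by rewrite sum_disjointU // big_imset //= => i j _ _; apply: winj.
Qed.

Let far_parts (P : {set T}) (Q J : {set I}) w : transversal w ->
    [disjoint Q & J] -> {in P, forall v, exists2 i, i \in Q & v \in part i} ->
  {in P & J, forall v j, (v != w j) && ~~ e v (w j)}.
Proof.
move=> wP dQJ PQ v j vP jJ; have [i iQ vi] := PQ v vP.
have ij : i != j by apply: contraTneq jJ => <-; rewrite (disjointFr dQJ iQ).
apply/andP; split.
  by apply: contraNneq ij => vw; rewrite -(part_lab vi) vw (part_lab (wP j)).
apply/negP => /(part_neighbor vi)/orP[wi|]; last by apply/negP/(part_out (wP j)).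
by rewrite -(part_lab wi) (part_lab (wP j)) eqxx in ij.
Qed.

(** Enlarge [P] by one vertex from each part of [J] before applying the bound on
    independent sets. *)
Lemma card_lt_degree (P : {set T}) (Q J : {set I}) v : independent e P ->
    [disjoint Q & J] -> {in P, forall v, exists2 i, i \in Q & v \in part i} ->
  v \in P -> #|P| + #|J| < degree e v.
Proof.
move=> indP dQJ PQ vP; have [w wP] := fin_all_exists (proj1 sep).
have [ind <- _] := independent_transversal wP indP (far_parts wP dQJ PQ).
by apply: indep_lt => //; rewrite in_setU vP.
Qed.

Let independent1 v : independent e [set v].
Proof. by apply/independentP => x y /set1P-> /set1P->; rewrite e_irr. Qed.

(** A vertex of the part belongs to a transversal of size [#|I|], so its degree
    exceeds [#|I|]. *)
Lemma card_part i : #|I| + 2 <= #|part i| + #|S|.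
Proof.
have [v vi] := proj1 sep i; rewrite -(degree_missed vi).
have dis : [disjoint [set i] & [set~ i]].
  by apply/pred0P => j /=; rewrite !inE andbN.
have P1 : {in [set v], forall u, exists2 j, j \in [set i] & u \in part j}.
  by move=> u /set1P->; exists i; rewrite ?set11.
have := card_lt_degree (independent1 v) dis P1 (set11 v).
rewrite cards1 cardsC1; have : 0 < #|I| by apply/card_gt0P; exists i.
by set d := degree e v; set m := missed v; lia.
Qed.

(** The degree-sum condition for [P] and one vertex [w j] of each part of [J].
    Each [degree e (w j)] is the size of its part plus [#|S| - 1 - missed (w j)],
    so the parts of [J] cancel against their contribution to [#|T|]; the parts
    outside [Q] and [J] are bounded below by [card_part]. *)
Lemma parts_degree_sum (P : {set T}) (Q J : {set I}) w : transversal w ->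
    independent e P -> [disjoint Q & J] ->
    {in P, forall v, exists2 i, i \in Q & v \in part i} -> #|P| + #|J| = k.+1 ->
  #|S| + \sum_(i in Q) #|part i| + #|J| + \sum_(j in J) missed (w j)
    + (#|I| - #|Q| - #|J|) * (#|I| + 2 - #|S|)
  <= \sum_(v in P) degree e v + #|J| * #|S|.
Proof.
move=> wP indP dQJ PQ cPJ.
have [ind card_ind sum_ind] :=
  independent_transversal wP indP (far_parts wP dQJ PQ).
have := degree_sum ind; rewrite card_ind sum_ind => /(_ cPJ).
rewrite card_all_parts.
have -> : \sum_i #|part i| = \sum_(i in Q) #|part i| + \sum_(i in J) #|part i|
    + \sum_(i in ~: (Q :|: J)) #|part i|.
  rewrite -sum_disjointU // (bigID [in Q :|: J]) /=; congr (_ + _).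
  by apply: eq_bigl => i; rewrite !inE.
have rest : (#|I| - #|Q| - #|J|) * (#|I| + 2 - #|S|) <=
    \sum_(i in ~: (Q :|: J)) #|part i|.
  have -> : #|I| - #|Q| - #|J| = #|~: (Q :|: J)|.
    rewrite -subnDA -(cardsC (Q :|: J)) cardsU (disjoint_setI0 dQJ) cards0 subn0.
    by rewrite addKn.
  rewrite -sum_nat_const; apply: leq_sum => i _.
  by rewrite leq_subLR [#|S| + _]addnC card_part.
have sumJ : \sum_(j in J) degree e (w j) + \sum_(j in J) missed (w j) + #|J| =
    \sum_(j in J) #|part j| + #|J| * #|S|.
  rewrite -sum_nat_const -[in X in _ + X = _]sum1_card -!big_split /=.
  by apply: eq_bigr => j _; rewrite (degree_missed (wP j)).
move: rest sumJ.
set x1 := (_ * (_ + 2 - _)); set x2 := \sum_(j in J) degree e _.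
set x3 := \sum_(j in J) missed _; set x4 := \sum_(j in J) #|part j|.
set x5 := _ * _; set x6 := \sum_(i in ~: _) _; set x7 := \sum_(i in Q) _.
set x8 := \sum_(v in P) _; lia.
Qed.

Lemma pair_degree_sum i u v (J : {set I}) w : transversal w ->
    u \in part i -> v \in part i -> u != v -> ~~ e u v ->
    i \notin J -> #|J|.+1 = k ->
  #|S| + #|part i| + #|J| + \sum_(j in J) missed (w j)
    + (#|I| - 1 - #|J|) * (#|I| + 2 - #|S|)
  <= degree e u + degree e v + #|J| * #|S|.
Proof.
move=> wP ui vi uv nuv iJ cJ.
have ind : independent e [set u; v] by apply: independent2.
have dis : [disjoint [set i] & J] by rewrite disjoints1.
have in_i : {in [set u; v], forall x, exists2 j, j \in [set i] & x \in part j}.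
  by move=> x /set2P[]->; exists i; rewrite ?set11.
have := parts_degree_sum wP ind dis in_i.
rewrite big_set1 cards1 cards2 uv -cJ add2n => /(_ erefl).
by rewrite big_setU1 ?inE //= big_set1.
Qed.

Lemma degree_le_inner v i : v \in part i -> degree e v <= inner_degree i v + #|S|.
Proof.
move=> vi; rewrite (degree_inner vi) leq_add2l; apply: subset_leq_card.
by apply/subsetP => z; rewrite inE => /andP[].
Qed.

Definition ore_part i := {in part i &, forall u v, u != v -> ~~ e u v ->
  #|part i| <= inner_degree i u + inner_degree i v}.

Lemma ore_part_dec i : ore_part i \/ exists u v,
  [/\ u \in part i, v \in part i, u != v, ~~ e u v &
      inner_degree i u + inner_degree i v < #|part i|].
Proof.
have [/existsP[u /existsP[v /and5P[ui vi uv nuv lt]]] | no_uv] :=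
    boolP [exists u, exists v, [&& u \in part i, v \in part i, u != v, ~~ e u v
      & inner_degree i u + inner_degree i v < #|part i|]].
  by right; exists u, v.
left=> u v ui vi uv nuv; rewrite leqNgt; apply: contra no_uv => lt.
by apply/existsP; exists u; apply/existsP; exists v; rewrite ui vi uv nuv.
Qed.

Lemma ore_part_cover i : ore_part i -> 2 < #|part i| -> cycle_cover e (part i) 1.
Proof. by move=> ore lt; apply: ore_cover. Qed.

Lemma ore_parts_cover (J : {set I}) :
    (forall i, i \in J -> 2 < #|part i|) ->
    (forall i, i \in J -> ore_part i) ->
  cycle_cover e (\bigcup_(i in J) part i) #|J|.
Proof.
move=> lt ore; apply: cycle_cover_bigcup => [i iJ | i j _ _].
  by apply: ore_part_cover; [apply: ore | apply: lt].
exact: disjoint_parts.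
Qed.

Lemma cover_with_separator (Q : {set I}) :
    cycle_cover e (S :|: \bigcup_(i in Q) part i) 1 ->
    (forall i, i \notin Q -> 2 < #|part i| /\ ore_part i) ->
  cycle_cover e setT (1 + #|~: Q|).
Proof.
move=> covQ rest.
have -> : [set: T] = (S :|: \bigcup_(i in Q) part i) :|:
    \bigcup_(i in ~: Q) part i.
  apply/esym/setP => v; rewrite in_setT !in_setU.
  have [//|vS /=] := boolP (v \in S).
  have vp : v \in part (lab v) by rewrite partE vS eqxx.
  have [lQ|lQ] := boolP (lab v \in Q).
    by apply/orP; left; apply/bigcupP; exists (lab v).
  by apply/orP; right; apply/bigcupP; exists (lab v); rewrite // in_setC.
apply: cycle_coverU covQ _; last first.
  by apply: ore_parts_cover => i; rewrite inE => /rest[].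
apply/pred0P => v /=; apply/negP => /andP[vQ /bigcupP[i iQ vi]].
move: vQ; rewrite in_setU (negPf (part_out vi)) => /bigcupP[j jQ vj].
by move: iQ; rewrite in_setC -(part_lab vi) (part_lab vj) jQ.
Qed.

Definition full i := [forall v in part i, missed v == 0].

Lemma full_adjacent i v u : full i -> v \in part i -> u \in part i :|: S ->
  u != v -> e v u.
Proof.
move=> /forall_inP fi vi uiS uv; have /eqP/card0_eq/(_ u) := fi v vi.
by rewrite inE (part_lab vi) uiS uv /= => /negbFE.
Qed.

Lemma full_ore i : full i -> ore_part i.
Proof.
move=> fi u v ui vi uv; rewrite (full_adjacent fi ui) ?in_setU ?vi //.
by rewrite eq_sym.
Qed.

Fixpoint weave (ss : seq T) (qs : seq I) : seq T :=
  if ss is x :: ss' then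
    if qs is i :: qs' then x :: enum (part i) ++ weave ss' qs' else [::]
  else [::].

Let full_to_S i v x : full i -> v \in part i -> x \in S -> e v x.
Proof.
move=> fi vi xS; apply: (full_adjacent fi vi); first by rewrite in_setU xS orbT.
by apply: contraTneq xS => ->; apply: part_out vi.
Qed.

Lemma path_weave ss qs y : size ss = size qs -> {subset ss <= S} ->
    (forall i, i \in qs -> full i) -> {in S, forall x, e y x} ->
  path e y (weave ss qs) /\ {in S, forall x, e (last y (weave ss qs)) x}.
Proof.
elim: ss qs y => [|x ss IH] [|i qs] y //= [sz] sS fqs yS.
have xS : x \in S by apply: sS; apply: mem_head.
have fi : full i by apply: fqs; apply: mem_head.
have all_in z : z \in enum (part i) -> z \in part i by rewrite mem_enum.
have [v0 v0i] := proj1 sep i.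
have [v [s def_s]] : exists v s, enum (part i) = v :: s.
  move: v0i; rewrite -mem_enum; case: (enum _) => // v s _.
  by exists v, s.
have ps : path e v s.
  have : pairwise (fun u v => u != v) (v :: s).
    by rewrite -uniq_pairwise -def_s enum_uniq.
  have : all (mem (part i)) (v :: s) by rewrite -def_s; apply/allP => z /all_in.
  move=> as_ /pairwise_sorted; apply: sub_in_path as_ => a b ai bi ab.
  by apply: (full_adjacent fi ai); rewrite ?in_setU ?bi // eq_sym.
have vi : v \in part i by apply: all_in; rewrite def_s mem_head.
have li : last v s \in part i by apply: all_in; rewrite def_s mem_last.
have sS' : {subset ss <= S} by move=> z zs; apply: sS; rewrite in_cons zs orbT.
have fqs' j : j \in qs -> full j by move=> jq; apply: fqs; rewrite in_cons jq orbT.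
have [pw lw] := IH qs (last v s) sz sS' fqs' (fun z => full_to_S fi li).
by rewrite def_s /= yS // e_sym (full_to_S fi vi) // cat_path ps pw last_cat.
Qed.

Lemma mem_weave ss qs : size ss = size qs -> {subset ss <= S} ->
  weave ss qs =i [pred v | (v \in ss) || (v \notin S) && (lab v \in qs)].
Proof.
elim: ss qs => [|x ss IH] [|i qs] //= sz sS v; first by rewrite !inE andbF.
case: sz => sz; rewrite in_cons mem_cat mem_enum IH // => [|z zs]; last first.
  by apply: sS; rewrite in_cons zs orbT.
rewrite [in RHS]inE /= !in_cons partE inE andb_orr.
by case: (v == x); case: (v \in ss); rewrite ?orbT.
Qed.

Lemma uniq_weave ss qs : size ss = size qs -> {subset ss <= S} ->
  uniq ss -> uniq qs -> uniq (weave ss qs).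
Proof.
elim: ss qs => [|x ss IH] [|i qs] // sz sS /= /andP[xss uss] /andP[iqs uqs].
have xS : x \in S by apply: sS; apply: mem_head.
have sS' : {subset ss <= S} by move=> z zs; apply: sS; rewrite in_cons zs orbT.
have sz' : size ss = size qs by case: sz.
rewrite mem_cat mem_enum partE xS mem_weave // inE (negPf xss) xS /=.
rewrite cat_uniq enum_uniq IH // andbT; apply/hasPn => v.
rewrite mem_weave // inE /= mem_enum partE => /orP[/sS' -> //|].
by case/andP=> _; apply: contraL => /andP[_ /eqP->].
Qed.

(** A full part can be traversed in any order, and both its ends are adjacent to
    all of [S]. *)
Lemma weave_cover (Q : {set I}) : 1 < #|S| -> #|Q| = #|S| ->
  (forall i, i \in Q -> full i) -> cycle_cover e (S :|: \bigcup_(i in Q) part i) 1.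
Proof.
move=> S2 QS fQ; pose L := weave (enum S) (enum Q).
have sz : size (enum S) = size (enum Q) by rewrite -!cardE.
have sS : {subset enum S <= S} by move=> v; rewrite mem_enum.
have fq i : i \in enum Q -> full i by rewrite mem_enum; apply: fQ.
have memL : L =i S :|: \bigcup_(i in Q) part i.
  move=> v; rewrite mem_weave // inE /= !mem_enum in_setU.
  have [//|vS] := boolP (v \in S); apply/idP/bigcupP => [lQ|[i iQ vi]].
    by exists (lab v); rewrite // partE vS eqxx.
  by rewrite (part_lab vi).
have uL : uniq L by apply: uniq_weave; rewrite ?enum_uniq.
have [i iQ] : exists i, i \in Q by apply/card_gt0P; rewrite QS; lia.
have [v vi] := proj1 sep i.
have [_ lastS] := path_weave sz sS fq (fun x => full_to_S (fQ i iQ) vi).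
have [pL _] := path_weave sz sS fq lastS.
apply: (cycle_cover1 _ _ uL memL); first by rewrite (cycle_path v).
rewrite -(card_uniqP uL) (eq_card memL).
have : S :|: [set v] \subset S :|: \bigcup_(i in Q) part i.
  by apply: setUS; rewrite sub1set; apply/bigcupP; exists i.
move/subset_leq_card; apply: leq_trans.
by rewrite setUC cardsU1 (part_out vi).
Qed.

(** By [slack], all but at most [k + 1 - #|S|] parts are full, which leaves at
    least [#|S|] full parts to weave with [S]. *)
Lemma cover_many_parts : 1 < #|I| -> #|S| + k - 1 <= #|I| -> k < #|I| ->
  cycle_cover e setT k.
Proof.
move=> I2 SkI kI.
have slack (J : {set I}) w : transversal w -> #|J| = k.+1 ->
    [/\ #|I| = #|S| + k - 1, 1 < #|S| &
        #|S| + \sum_(j in J) missed (w j) <= k.+1].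
  move=> wP cJ.
  have ind0 : independent e set0 by apply/independentP => u v; rewrite inE.
  have dis0 : [disjoint (set0 : {set I}) & J].
    by apply/pred0P => j /=; rewrite in_set0.
  have out0 : {in set0, forall v, exists2 i, i \in set0 & v \in part i}.
    by move=> v; rewrite inE.
  have := parts_degree_sum wP ind0 dis0 out0.
  rewrite !big_set0 !cards0 cJ subn0 !add0n addn0 => /(_ erefl).
  move: (\sum_(j in J) _) SkI kI => D; move: (#|I|) (#|S|) k_gt0 => m s k0 SkI kI.
  (* With more than [s + k - 1] parts, those outside [J] are too large in total. *)
  have [sm|sm] := leqP (s + k) m.
    have lem : (s - 1) * (k + 2) <= (m - k.+1) * (m + 2 - s).
      by apply: leq_mul; lia.
    nia.
  have -> : m = s + k - 1 by lia.
  have -> : s + k - 1 - k.+1 = s - 2 by lia.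
  have -> : s + k - 1 + 2 - s = k.+1 by lia.
  have s2 : 1 < s by lia.
  move=> sum; split=> //.
  have : (s - 2) * k.+1 + 2 * k.+1 = k.+1 * s by nia.
  lia.
have [w0 w0P] := fin_all_exists (proj1 sep).
have [J0 _ cJ0] : exists2 J0 : {set I}, J0 \subset setT & #|J0| = k.+1.
  by apply: subset_of_card; rewrite cardsT.
have [cI S2 _] := slack J0 w0 w0P cJ0.
pose F := [set i | full i].
have F_S : #|S| <= #|F|.
  rewrite leqNgt; apply/negP => ltF.
  (* Otherwise [k] parts are not full; a missing adjacency in each of them makes
     the total at least [k], above the permitted [k + 1 - #|S|]. *)
  have [B sB cB] : exists2 B : {set I}, B \subset ~: F & #|B| = k.
    apply: subset_of_card; have := cardsC F; lia.
  have [i iB] : exists i, i \notin B.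
    have : 0 < #|~: B| by have := cardsC B; lia.
    by case/card_gt0P => i; rewrite inE; exists i.
  have : forall j, exists v, (v \in part j) && (full j || (0 < missed v)).
    move=> j; have [fj|/forall_inPn[v vj mv]] := boolP (full j).
      by have [v vj] := proj1 sep j; exists v; rewrite vj.
    by exists v; rewrite vj lt0n mv orbT.
  case/fin_all_exists => w wP.
  have wt : transversal w by move=> j; case/andP: (wP j).
  have cJ : #|i |: B| = k.+1 by rewrite cardsU1 iB cB.
  have [_ _] := slack _ w wt cJ.
  rewrite big_setU1 //=.
  have : #|B| <= \sum_(j in B) missed (w j).
    rewrite -sum1_card; apply: leq_sum => j jB; have := subsetP sB j jB.
    by rewrite !inE => /negPf nf; have /andP[_] := wP j; rewrite nf.
  rewrite cB; lia.
have [Q sQ cQ] := subset_of_card F_S.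
have QF i : i \in Q -> full i by move/(subsetP sQ); rewrite inE.
have -> : k = 1 + #|~: Q| by have := cardsC Q; lia.
apply: cover_with_separator (weave_cover S2 cQ QF) _ => i iQ.
have k2 : 1 < k.
  have : 0 < #|~: Q| by apply/card_gt0P; exists i; rewrite inE.
  by have := cardsC Q; lia.
have part_i := card_part i; split; first by lia.
move=> u v ui vi uv nuv.
have [J sJ cJ] : exists2 J : {set I}, J \subset [set~ i] & #|J| = k.-1.
  by apply: subset_of_card; rewrite cardsC1; lia.
have iJ : i \notin J by apply/negP => /(subsetP sJ); rewrite !inE eqxx.
have cJ1 : #|J|.+1 = k by rewrite cJ prednK.
have := pair_degree_sum w0P ui vi uv nuv iJ cJ1.
rewrite cJ cI.
have := degree_le_inner ui; have := degree_le_inner vi.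
move: (inner_degree i u) (inner_degree i v) (degree e u) (degree e v).
move: (\sum_(j in J) _) S2 part_i k2; rewrite cI.
move: (#|S|) (#|part i|) => s p D s2 pi k2 iu iv du dv lv lu.
have -> : s + k - 1 - 1 - k.-1 = s - 1 by nat_lia.
have -> : s + k - 1 + 2 - s = k.+1 by nat_lia.
have e1 : (s - 1) * k.+1 = (s - 1) * k.-1 + (s - 1) * 2.
  by rewrite -mulnDr; congr (_ * _); nat_lia.
have e2 : k.-1 * s = (s - 1) * k.-1 + k.-1.
  by rewrite -mulSnr subn1 prednK 1?mulnC //; nat_lia.
nat_lia.
Qed.

(** If all parts satisfy Ore's condition, some part contains two neighbours of
    [x]: otherwise [x] with a non-neighbour in each part is an independent set of
    size [k + 1], while [degree e x <= k].  If a part fails it at [u] and [v], then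
    the degree sum is only met when [x] is adjacent to [u] and [v] and all other
    parts are full. *)
Lemma cover_one_cut x : S = [set x] -> 1 < #|I| -> #|I| = k ->
  cycle_cover e setT k.
Proof.
move=> Sx I2 cI.
have sum i u v w : u \in part i -> v \in part i -> u != v -> ~~ e u v ->
    transversal w ->
    #|part i| + 1 + \sum_(j in [set~ i]) missed (w j) <= degree e u + degree e v.
  move=> ui vi uv nuv wP; have := @pair_degree_sum i u v [set~ i] w wP ui vi uv nuv.
  rewrite cardsC1 Sx cards1 cI !inE eqxx muln1 => /(_ isT).
  have -> : k - 1 - k.-1 = 0 by lia.
  rewrite prednK // mul0n => /(_ erefl).
  lia.
have part3 i : 2 < #|part i| by have := card_part i; rewrite Sx cards1; lia.
have degS v : #|[set z in S | e v z]| = e v x.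
  case evx: (e v x); last first.
    by rewrite eq_card0 // => z; rewrite Sx !inE; case: eqP => // ->; rewrite evx.
  transitivity #|[set x]|; last by rewrite cards1.
  apply: eq_card => z; rewrite Sx !inE.
  by case: eqP => // ->; rewrite evx.
have [i [y [z [[yi zi] yz exy exz rest]]]] : exists i y z,
    [/\ y \in part i /\ z \in part i, y != z, e x y, e x z &
        forall j, j != i -> ore_part j].
  have all_or : (forall i, ore_part i) \/ exists i u v,
      [/\ u \in part i, v \in part i, u != v, ~~ e u v &
          inner_degree i u + inner_degree i v < #|part i|].
    exact: fin_forall_or ore_part_dec.
  case: all_or => [all_good | [i [u [v [ui vi uv nuv lt]]]]].
    have [/existsP[i gt1] | /existsPn le1] :=
        boolP [exists i, 1 < #|[set z in part i | e x z]|].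
      have /card_gt1P[y [z [yN zN yz]]] := gt1.
      exists i, y, z; move: yN zN; rewrite !inE -!partE.
      move=> /andP[yi exy] /andP[zi exz]; by split.
    have ex_w : forall i, exists v, (v \in part i) && ~~ e x v.
      move=> i; apply/existsP; rewrite -negb_forall_in; apply/negP => /forall_inP all_x.
      have := le1 i; rewrite -leqNgt leqNgt => /negP; apply.
      apply: leq_trans (ltnW (part3 i)) _; apply: subset_leq_card.
      by apply/subsetP => v vi; rewrite inE vi all_x.
    have [w wP] := fin_all_exists ex_w.
    have wt : transversal w by move=> i; case/andP: (wP i).
    have far : {in [set x] & setT, forall v j, (v != w j) && ~~ e v (w j)}.
      move=> v j /set1P-> _; have /andP[wj ->] := wP j; rewrite andbT.
      by apply: contraTneq wj => <-; rewrite partE Sx inE eqxx.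
    have [indJ cardJ _] := independent_transversal wt (independent1 x) far.
    have := @indep_lt _ x indJ; rewrite cardJ cards1 cardsT cI in_setU set11.
    move=> /(_ isT).
    have : degree e x <= k.
      rewrite /degree card_parts -cI -[#|I|]sum1_card.
      have -> : [set u | e x u] :&: S = set0.
        by apply/setP => v; rewrite Sx !inE; case: eqP => [->|]; rewrite ?e_irr ?andbF.
      rewrite cards0 add0n; apply: leq_sum => i _.
      have := le1 i; rewrite -leqNgt; apply: leq_trans.
      by apply: subset_leq_card; apply/subsetP => v; rewrite !inE andbC.
    lia.
  have key w : transversal w ->
      [/\ e u x, e v x & \sum_(j in [set~ i]) missed (w j) = 0].
    move=> wP; have := sum i u v w ui vi uv nuv wP.
    rewrite (degree_inner ui) (degree_inner vi) !degS.
    move: lt; move: (inner_degree i u) (inner_degree i v) (\sum_(j in _) _) => a b D.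
    by case: (e u x); case: (e v x) => /=; split=> //; lia.
  have [w0 w0P] := fin_all_exists (proj1 sep).
  have [eux evx _] := key w0 w0P.
  exists i, u, v; rewrite ![e x _]e_sym; split=> // j ji; apply: full_ore.
  apply/forall_inP => a aj; have [w wP wa] := transversal_through aj.
  have [_ _ /eqP] := key w wP; rewrite sum_nat_eq0 => /forall_inP/(_ j).
  by rewrite !inE wa; apply.
have -> : k = 1 + #|~: [set i]| by rewrite cardsC1 cI; lia.
apply: cover_with_separator => [|j]; last by rewrite inE => ji; split; [|exact: rest].
rewrite big_set1 Sx; apply: (ore_cover_add e_sym e_irr _ yi zi yz exy exz).
  by rewrite partE Sx inE eqxx.
move=> u v ui vi uv nuv; have [w0 w0P] := fin_all_exists (proj1 sep).
have sub a : a \in part i -> degree e a <= #|[set w in x |: part i | e a w]|.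
  move=> ai; apply: subset_leq_card; apply/subsetP => b; rewrite inE => eab.
  rewrite inE eab andbT in_setU1; have := part_neighbor ai eab.
  by rewrite Sx in_set1 orbC.
by have := sum i u v w0 ui vi uv nuv w0P; have := sub u ui; have := sub v vi; nat_lia.
Qed.

Lemma cover_no_cut : S = set0 -> 1 < #|I| -> #|I| = k -> cycle_cover e setT k.
Proof.
move=> S0 I2 cI.
have part3 i : 2 < #|part i| by have := card_part i; rewrite S0 cards0; lia.
have -> : [set: T] = \bigcup_(i in setT) part i.
  apply/esym/setP => v; rewrite in_setT; apply/bigcupP; exists (lab v) => //.
  by rewrite partE S0 inE eqxx.
rewrite -cI -cardsT; apply: ore_parts_cover => // i _ u v ui vi uv nuv.
have [w wP] := fin_all_exists (proj1 sep).
have := @pair_degree_sum i u v [set~ i] w wP ui vi uv nuv.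
rewrite cardsC1 S0 cards0 cI !inE eqxx muln0 => /(_ isT).
have -> : k - 1 - k.-1 = 0 by lia.
  rewrite prednK // mul0n => /(_ erefl).
have := degree_le_inner ui; have := degree_le_inner vi; rewrite S0 cards0.
lia.
Qed.

Lemma separation_cover : 1 < #|I| -> #|S| + k - 1 <= #|I| -> k <= #|I| ->
  cycle_cover e setT k.
Proof.
move=> I2 SkI kI; have [ltk|lek] := ltnP k #|I|; first exact: cover_many_parts.
have cI : #|I| = k by lia.
have [S0|[x xS]] := set_0Vmem S; first exact: cover_no_cut.
have S1 : 0 < #|S| by apply/card_gt0P; exists x.
have /cards1P[y Sy] : #|S| == 1 by apply/eqP; lia.
exact: (cover_one_cut Sy).
Qed.

End Separation.

(** Ore's condition cannot fail in two parts: two non-adjacent pairs, with one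
    vertex from each other part, form an independent set of size [k + 1] whose
    degree sum would be too small.  So one part [C i] may need two cycles, and the
    others one each. *)
Lemma cover_disconnected (I : finType) (lab : T -> I) :
  separates set0 lab -> 1 < #|I| -> #|I|.+1 = k -> cycle_cover e setT k.
Proof.
move=> sep I2 cI.
pose C i := part set0 lab i.
have inC v i : (v \in C i) = (lab v == i) by rewrite !inE.
have closed i u v : u \in C i -> e u v -> v \in C i.
  by move=> ui euv; have := part_neighbor sep ui euv; rewrite in_set0 orbF.
have [w wP] := fin_all_exists (proj1 sep).
have big i : 2 < #|C i| by have := card_part sep i; rewrite cards0 /C; nat_lia.
have inner i v : v \in C i -> degree e v <= #|[set z in C i | e v z]|.
  by move=> vi; have := degree_le_inner sep vi; rewrite cards0 addn0.
have ore_or i j u v u' v' : i != j -> u \in C i -> v \in C i -> u != v ->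
    ~~ e u v -> u' \in C j -> v' \in C j -> u' != v' -> ~~ e u' v' ->
    #|C i| + #|C j| <= degree e u + degree e v + (degree e u' + degree e v').
  move=> ij ui vi uv nuv uj vj uv' nuv'.
  have far a b : a \in C i -> b \in C j -> (a != b) && ~~ e a b.
    move=> ai bj; have nai : b \notin C i.
      by move: bj; rewrite !inC => /eqP->; rewrite eq_sym.
    rewrite (contraNneq _ nai) => [|<- //]; apply: contra nai; exact: closed ai.
  have dis2 : [disjoint [set u; v] & [set u'; v']].
    apply/pred0P => a /=; apply/negP => /andP[/set2P au /set2P av].
    have ai : a \in C i by case: au => ->.
    have aj : a \in C j by case: av => ->.
    by have := far a a ai aj; rewrite eqxx.
  have ind : independent e ([set u; v] :|: [set u'; v']).
    apply: independentU; rewrite ?independent2 // => a b /set2P au /set2P bv.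
    have ai : a \in C i by case: au => ->.
    have bj : b \in C j by case: bv => ->.
    by case/andP: (far a b ai bj).
  have disJ : [disjoint [set i; j] & ~: [set i; j]].
    by apply/pred0P => a /=; rewrite !inE andbN.
  have inQ : {in [set u; v] :|: [set u'; v'],
      forall a, exists2 l, l \in [set i; j] & a \in C l}.
    move=> a; rewrite in_setU => /orP[]/set2P aE; [exists i | exists j];
      by rewrite ?set21 ?set22 //; case: aE => ->.
  have := parts_degree_sum sep wP ind disJ inQ.
  have cQ := cardsC [set i; j]; have c2 : #|[set i; j]| = 2 by rewrite cards2 ij.
  rewrite cardsU (disjoint_setI0 dis2) !cards0 !cards2 uv uv' ij /=.
  rewrite (sum_disjointU _ dis2) !big_setU1 ?inE //= !big_set1 muln0 addn0.
  rewrite c2 in cQ; rewrite -/(C i) -/(C j) => sum.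
  apply: leq_trans (sum _); last by nat_lia.
  by rewrite add0n -!addnA leq_add2l leq_addr.
have [i rest] : exists i, forall j, j != i -> ore_part set0 lab j.
  have [all_ore | [i [u [v [ui vi uv nuv lt]]]]] :=
      fin_forall_or (ore_part_dec set0 lab).
    have /card_gt0P[i _] : 0 < #|I| by nat_lia.
    by exists i.
  exists i => j ji; have [//|[u' [v' [uj vj uv' nuv' lt']]]] := ore_part_dec set0 lab j.
  have := ore_or i j u v u' v'; rewrite eq_sym ji => /(_ isT ui vi uv nuv uj vj uv' nuv').
  have := (inner i u ui, inner i v vi, (inner j u' uj, inner j v' vj)).
  move=> [[l1 l2] [l3 l4]]; move: lt lt'; rewrite /inner_degree.
  rewrite -/(C i) -/(C j); nat_lia.
(* If at most one vertex [X] disconnects [C i], cutting [C i] there yields a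
   separation into [k] parts. *)
have [/existsP[X /existsP[B]] | connected] := boolP [exists X : {set T},
    exists B : {set T}, [&& #|X| <= 1, X \subset C i, B \subset C i,
      [disjoint X & B], B != set0, ~~ (C i \subset X :|: B) &
      [forall u in B, forall v in C i, e u v ==> (v \in X :|: B)]]].
  case/and5P=> X1 sX sB dXB /and3P[/set0Pn[b bB] /subsetPn[d di dXB'] /forall_inP noe].
  have noe' u v : u \in B -> v \notin X -> e u v -> v \in B.
    move=> uB vX euv; have vi := closed i u v (subsetP sB u uB) euv.
    have /forall_inP/(_ v vi)/implyP/(_ euv) := noe u uB.
    by rewrite in_setU (negPf vX).
  apply: (@separation_cover (option I) X
    (fun v => if v \in B then None else Some (lab v))).
  - split=> [[j|]|u v uX vX euv].
    + have [->|ji] := eqVneq j i.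
        exists d; move: dXB'; rewrite in_setU negb_or inE => /andP[-> /negPf->] /=.
        by move: di; rewrite inC => /eqP->.
      have [v vj] := proj1 sep j; exists v.
      have vi : v \notin C i by move: vj; rewrite (inC v j) inC => /eqP->.
      rewrite inE (contra (subsetP sX v)) //= (negPf (contra (subsetP sB v) vi)).
      by move: vj; rewrite (inC v j) => /eqP->.
    + exists b; rewrite inE bB eqxx andbT; apply/negP => bX.
      by rewrite (disjointFr dXB bX) in bB.
    case: ifP => uB; case: ifP => vB //.
    + by rewrite (noe' u v) in vB.
    + by rewrite (noe' v u) // e_sym in uB.
    by rewrite (proj2 sep u v) ?inE.
  - by rewrite card_option; nat_lia.
  - by rewrite card_option; nat_lia.
  by rewrite card_option; nat_lia.
suff cov2 : cycle_cover e (C i) 2.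
  have -> : [set: T] = C i :|: \bigcup_(j in [set~ i]) part set0 lab j.
    apply/esym/setP => v; rewrite in_setT in_setU inC.
    have [//|vi /=] := eqVneq (lab v) i.
    by apply/bigcupP; exists (lab v); rewrite ?inE ?vi ?eqxx.
  have -> : k = 2 + #|[set~ i]| by rewrite cardsC1; nat_lia.
  apply: cycle_coverU cov2 _; last first.
    apply: ore_parts_cover => j; rewrite !inE => ji; first exact: big.
    exact: rest.
  apply/pred0P => v /=; apply/negP => /andP[vi /bigcupP[j]].
  rewrite in_setC in_set1 => ji vj; move: vi; rewrite inC => /eqP vi.
  by move: vj ji; rewrite (inC v j) vi eq_sym => ->.
(* Here [k >= 3]: the parts other than [C i] contribute at least 1 to the slack. *)
have triple x y z : x \in C i -> y \in C i -> z \in C i ->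
    x != y -> x != z -> y != z -> ~~ e x y -> ~~ e x z -> ~~ e y z ->
    #|C i| < degree e x + degree e y + degree e z.
  move=> xi yi zi xy xz yz nxy nxz nyz.
  have ind : independent e (x |: [set y; z]).
    apply: independentU; rewrite ?independent2 //.
      by apply/independentP => a b /set1P-> /set1P->; rewrite e_irr.
    by move=> a b /set1P-> /set2P[]->.
  have disJ : [disjoint [set i] & [set~ i]].
    by apply/pred0P => a /=; rewrite !inE andbN.
  have inQ : {in x |: [set y; z], forall a, exists2 l, l \in [set i] & a \in C l}.
    by move=> a /setU1P[->|/set2P[]->]; exists i; rewrite ?set11.
  have := parts_degree_sum sep wP ind disJ inQ.
  have x_yz : x \notin [set y; z] by rewrite !inE negb_or xy.
  rewrite cardsU1 x_yz cards2 yz cards1 cardsC1 !cards0 big_set1 muln0 addn0.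
  rewrite big_setU1 //= big_setU1 ?inE //= big_set1 -/(C i) => sum.
  have h : 1 + 2 + #|I|.-1 = k.+1 by nat_lia.
  rewrite -addnA; apply: leq_trans (sum h); rewrite add0n -addn1 -!addnA.
  by rewrite leq_add2l addn_gt0 -subn1 subn_gt0 I2.
have indep_i (J : {set T}) v : J \subset C i -> independent e J -> v \in J ->
    #|J| + 2 <= degree e v.
  move=> sJ indJ vJ; have disJ : [disjoint [set i] & [set~ i]].
    by apply/pred0P => a /=; rewrite !inE andbN.
  have inQ : {in J, forall a, exists2 l, l \in [set i] & a \in C l}.
    by move=> a /(subsetP sJ) ai; exists i; rewrite ?set11.
  have := card_lt_degree sep indJ disJ inQ vJ; rewrite cardsC1; nat_lia.
have [v vi] := proj1 sep i.
apply: (two_cycles e_sym e_irr (closed i) triple indep_i _ vi).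
move=> X B X1 sX sB dXB B0 nsub.
have [/existsP[u /existsP[z /and5P[uB zi zX zB euz]]] | noe] :=
    boolP [exists u, exists z, [&& u \in B, z \in C i, z \notin X, z \notin B & e u z]].
  by exists u, z.
case/negP: connected; apply/existsP; exists X; apply/existsP; exists B.
rewrite X1 sX sB dXB B0 nsub /=; apply/forall_inP => u uB; apply/forall_inP => z zi.
apply/implyP => euz; apply: contraR noe; rewrite in_setU negb_or => /andP[zX zB].
by apply/existsP; exists u; apply/existsP; exists z; rewrite uB zi zX zB.
Qed.

End Parts.

(** * From cut sets to separations *)

Lemma bigminn_le (I : finType) (P : pred I) (F : I -> nat) m j :
  P j -> \big[minn/m]_(i | P i) F i <= F j.
Proof.
move=> Pj; have : j \in index_enum I by rewrite mem_index_enum.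
elim: (index_enum I) => // i s IH; rewrite inE big_cons.
case/predU1P => [<-|js]; first by rewrite Pj geq_minl.
by case: ifP => _; [apply: leq_trans (geq_minr _ _) (IH js) | apply: IH].
Qed.

Lemma sigma_le (T : finType) (e : rel T) m n : leq_inf n (sigma e m) ->
  forall J : {set T}, independent e J -> #|J| = m ->
  n <= \sum_(v in J) degree e v.
Proof.
move=> + J indJ cJ; rewrite /sigma.
have -> : m <= alpha e.
  by rewrite -cJ; apply: (leq_bigmax_cond (F := fun I : {set T} => #|I|)).
move=> /= /leq_trans; apply.
apply: (bigminn_le (fun J : {set T} => \sum_(v in J) degree e v)).
by rewrite indJ cJ eqxx.
Qed.

Lemma min_degree_lt (T : finType) (e : rel T) :
    (forall J : {set T}, J != set0 -> independent e J -> #|J| <= min_degree e J - 1) ->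
  forall (J : {set T}) v, independent e J -> v \in J -> #|J| < degree e v.
Proof.
move=> small J v indJ vJ.
have J0 : J != set0 by apply/set0Pn; exists v.
have minv : min_degree e J <= degree e v by apply: bigminn_le.
have J1 : 0 < #|J| by rewrite card_gt0.
by have := small J J0 indJ; lia.
Qed.

(** The components are indexed by their roots outside [S]. *)
Lemma components_separate (T : finType) (e : rel T) (S : {set T}) :
    symmetric e -> cut_set e S ->
  exists (I : finType) (lab : T -> I),
    [/\ separates e S lab, #|I| = omega e S & 1 < #|I|].
Proof.
move=> e_sym [u [v [uS vS nuv]]].
have csym := connect_del_sym e_sym S.
have out x y : x \notin S -> connect (del e S) x y -> y \notin S.
  move=> xS /connectP[p]; elim: p x xS => [|z p IH] x xS /=; first by move=> _ ->.
  by case/andP=> /and3P[_ zS _]; apply: IH.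
pose P x := (root (del e S) x == x) && (x \notin S).
have P_root x : x \notin S -> P (root (del e S) x).
  by move=> xS; rewrite /P root_root // eqxx (out x) ?connect_root.
pose iu : {x | P x} := Sub (root (del e S) u) (P_root u uS).
pose iv : {x | P x} := Sub (root (del e S) v) (P_root v vS).
pose lab x : {x | P x} := insubd iu (root (del e S) x).
have val_lab x : x \notin S -> val (lab x) = root (del e S) x.
  by move=> xS; apply: insubdK; apply: (P_root x xS).
exists {x | P x}, lab; split; last first.
- apply/card_gt1P; exists iu, iv; split=> //; apply: contra nuv => /eqP uv.
  by apply/(rootP csym); have := congr1 val uv; rewrite !SubK.
- by rewrite card_sig; apply: eq_card => x; rewrite !inE.
split=> [i|x y xS yS exy].
  have /andP[/eqP ri iS] := valP i; exists (val i); rewrite inE iS /=.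
  by apply/eqP/val_inj; rewrite val_lab.
apply: val_inj; rewrite !val_lab //; apply/(rootP csym)/connect1.
by rewrite /del /= xS yS.
Qed.

Theorem theorem8 (T : finType) (e : rel T)
    (e_sym : symmetric e) (e_irr : irreflexive e) (k : nat) (k_gt0 : 0 < k)
    (h_sigma : leq_inf #|T| (sigma e k.+1))
    (h_indep : forall I : {set T}, I != set0 -> independent e I ->
       #|I| <= min_degree e I - 1)
    (h_cut : exists2 S : {set T}, cut_set e S & #|S| + k - 1 <= omega e S) :
  exists2 F : rel T, two_factor e F & num_cycles F <= k.
Proof.
have deg_sum := sigma_le h_sigma; have indep_lt := min_degree_lt h_indep.
apply: cycle_cover_two_factor => //; case: h_cut => S cutS.
have [I [lab [sep <- I2]]] := components_separate e_sym cutS => SkI.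
have [kI|Ik] := leqP k #|I|.
  exact: (separation_cover e_sym e_irr k_gt0 deg_sum indep_lt sep).
have S0 : S = set0 by apply/eqP; rewrite -cards_eq0; apply/eqP; lia.
have cI : #|I|.+1 = k by lia.
rewrite S0 in sep.
exact: (cover_disconnected e_sym e_irr k_gt0 deg_sum indep_lt sep).
Qed.
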